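(* Let $f:\mathbb{R}^2\to\mathbb{R}$ be a smooth, radial function with $f\in L^1(\mathbb{R}^2)$ and $f(0)\neq 0$. Then $$e^{R_1t}f(0)= f(0)\sqrt{\frac{2}{\pi t}}\,\cos\!\left(t-\frac{\pi}{4}\right)+o(t^{-1/2}) \qquad\text{as } t\rightarrow \infty.$$
   Context: The Fourier transform $\hat f$ on $\mathbb{R}^2$ is normalized so that $f(x)=\int_{\mathbb{R}^2}\hat f(\xi)e^{ix\cdot\xi}\,d\xi$. $R_1$ is the Riesz transform in $x_1$, the Fourier multiplier with symbol $-i\xi_1/|\xi|$, and $e^{R_1t}$ is the semigroup of the linear equation $\partial_t\omega-R_1\omega=0$ on $\mathbb{R}^2$, i.e. the Fourier multiplier with symbol $e^{-it\xi_1/|\xi|}$: $$e^{R_1 t}f(x)=\int_{\mathbb{R}^2}\hat{f}(\xi)e^{ix\cdot\xi -it\frac{\xi_1}{|\xi|}}\, d\xi ,$$ with the integral understood as an inverse Fourier transform of tempered distributions if $\hat f$ is not integrable; $e^{R_1t}f(0)$ denotes the value of the function $e^{R_1t}f$ at $x=0$. *)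

(* Defs.v *)
From HB Require Import structures.
From mathcomp Require Import all_boot all_order all_algebra.
From mathcomp Require Import all_classical all_reals all_analysis.
From mathcomp Require Import complex.

Set Implicit Arguments.
Unset Strict Implicit.
Unset Printing Implicit Defensive.

Import Order.TTheory GRing.Theory Num.Theory.
Import numFieldNormedType.Exports.

Local Open Scope classical_set_scope.
Local Open Scope ring_scope.
Local Open Scope complex_scope.

(* Lets the Landau notations be used at +oo. *)
Canonical pinfty_filter_on (R : realType) :=
  FilterType (pinfty_nbhs R) (@filter_filter R _ _).

Section Plane.
Context {R : realType}.

Definition dot2 (x y : R * R) : R := x.1 * y.1 + x.2 * y.2.

(* The norm that the library puts on a product is the sup norm, hence this
   Euclidean one. *)
Definition enorm (x : R * R) : R := Num.sqrt (dot2 x x).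

Definition radial (f : R * R -> R) : Prop :=
  forall x y : R * R, enorm x = enorm y -> f x = f y.

Fixpoint Ck (n : nat) (f : R * R -> R) : Prop :=
  continuous f /\
  match n with
  | 0 => True
  | m.+1 =>
      [/\ forall x, derivable f x (1, 0), forall x, derivable f x (0, 1),
          Ck m (fun x => 'D_(1, 0) f x) & Ck m (fun x => 'D_(0, 1) f x)]
  end.

Definition smooth (f : R * R -> R) : Prop := forall n, Ck n f.

Definition lebesgue2 := ((@lebesgue_measure R) \x (@lebesgue_measure R))%E.

Definition L1 (f : R * R -> R) : Prop :=
  lebesgue2.-integrable setT (EFin \o f).

(* Complex-valued functions are continuous, integrable, smooth or integrated
   componentwise. *)
Definition Ccontinuous (h : R * R -> R[i]) : Prop :=
  continuous (fun x => complex.Re (h x)) /\ continuous (fun x => complex.Im (h x)).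

Definition CL1 (h : R * R -> R[i]) : Prop :=
  L1 (fun x => complex.Re (h x)) /\ L1 (fun x => complex.Im (h x)).

Definition Cint (h : R * R -> R[i]) : R[i] :=
  Rintegral lebesgue2 setT (fun x => complex.Re (h x)) +i*
  Rintegral lebesgue2 setT (fun x => complex.Im (h x)).

Definition expi (a : R) : R[i] := cos a +i* sin a.

(* Normalized so that f x = \int hat f(xi) e^(i x.xi) dxi: the factor
   (2 pi)^(-2) sits here and the inverse transform carries none. *)
Definition fourier (f : R * R -> R) (xi : R * R) : R[i] :=
  (((2 * pi) ^+ 2)^-1)%:C * Cint (fun x => (f x)%:C * expi (- dot2 x xi)).

Definition inv_fourier (h : R * R -> R[i]) (x : R * R) : R[i] :=
  Cint (fun xi => h xi * expi (dot2 x xi)).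

(* e^(-i t xi_1 / |xi|), and 1 at the negligible point xi = 0. *)
Definition semigroup_symbol (t : R) (xi : R * R) : R[i] :=
  expi (- (t * (xi.1 / enorm xi))).

Definition test_function (phi : R * R -> R[i]) : Prop :=
  [/\ smooth (fun x => complex.Re (phi x)), smooth (fun x => complex.Im (phi x)) &
      exists M : R, forall x, M < enorm x -> phi x = 0].

(* Distributions are functionals on functions R^2 -> C; only their values on
   Schwartz functions matter. *)
Definition dist_of (h : R * R -> R[i]) (phi : R * R -> R[i]) : R[i] :=
  Cint (fun x => h x * phi x).

Definition inv_fourier_dist (T : (R * R -> R[i]) -> R[i])
    (phi : R * R -> R[i]) : R[i] :=
  T (inv_fourier phi).

(* Compactly supported test functions are dense in the Schwartz space, so they
   determine a tempered distribution. Testing against every Schwartz function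
   would not do: a continuous function that is a tempered distribution may grow
   so fast that its product with a Schwartz function is not integrable. *)
Definition dist_is_function (T : (R * R -> R[i]) -> R[i])
    (g : R * R -> R[i]) : Prop :=
  Ccontinuous g /\ forall phi, test_function phi -> T phi = dist_of g phi.

(* g is the function e^(R_1 t) f, for f in L^1. If hat f is integrable, it is
   the integral of hat f(xi) e^(i x.xi - i t xi_1 / |xi|). If not, it is the
   continuous function equal to the inverse Fourier transform of the tempered
   distribution given by the bounded function e^(-i t xi_1 / |xi|) hat f(xi);
   there is at most one such g, and there is one when f is smooth and
   integrable, because the symbol is smooth away from 0 and homogeneous of
   degree 0. *)
Definition is_semigroup (f : R * R -> R) (t : R) (g : R * R -> R[i]) : Prop :=
  let h := fun xi => fourier f xi * semigroup_symbol t xi in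
  (CL1 (fourier f) -> g = inv_fourier h) /\
  (~ CL1 (fourier f) -> dist_is_function (inv_fourier_dist (dist_of h)) g).

End Plane.

(* Main.v *)
Require Import Defs.
From HB Require Import structures.
From mathcomp Require Import all_boot all_order all_algebra.
From mathcomp Require Import all_classical all_reals all_analysis.
From mathcomp Require Import complex.
From mathcomp Require Import measurable_realfun lebesgue_integral_fubini.
From mathcomp Require Import ring lra.

(** Both cases of the definition of the semigroup give, for t > 0,
      e^(R_1 t) f (0) = f(0) J(t),  J(t) = 2/pi int_0^(pi/2) cos(t cos a) da,
    where J is the Bessel function J_0, and the expansion of J at infinity
    gives the claim, even with an error O(1/t).

    The factor J comes from averaging over rotations: if F is integrable and
    invariant under rotations, the integral of F(xi) cos(t xi_1/|xi|) does not
    change when xi is rotated, and the mean of cos(t xi_1/|xi|) over the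
    rotations is J(t) for every xi <> 0 ([rotation_average]). The sine part of
    the symbol is odd and contributes nothing.

    If the transform of f is integrable, it only remains to see that its
    integral is f(0) ([integral_rfourier]). If it is not, the semigroup is
    known only by testing; tested against the bump
    [mollifier e] (x) = exp(-1/(e^2 - |x|^2)), the same averaging gives
    J(t) int f [mollifier e] ([rfourier_pairing]), and the bumps, normalized by
    their mass, concentrate at 0, where the function under study is continuous
    ([mollify_cvg], [semigroup_at_origin]). Moving the transform from f to the
    bump needs Fourier inversion for the bump. It rests on two facts: the
    transform of the bump is integrable, because it decays like |xi|^(-4) by
    integration by parts ([mollifier_cosft_decay]); and the transform of
    e^(-e (|x_1| + |x_2|)) is an explicit positive kernel of total mass
    (2 pi)^2 that concentrates at 0 ([poisson_kernel], [cosft_inversion]).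
    All functions involved are even, so that the real cosine transform
    [cosft] is enough.

    For the expansion of J, the phase is stationary only at a = 0, and there
    1 - cos a = 2 sin^2 (a/2). Replacing 1 by cos (a/2) in the integral costs
    O(1/t): the difference 1 - cos (a/2) vanishes to second order at a = 0, so
    that one can integrate by parts ([half_angle_remainder]). For the weight
    cos (a/2) one has
      sqrt(2 pi/t) cos (a/2) = int_R sin a e^(-t (1 - cos a) s^2) ds,
    and after exchanging the integrals the integral in a is elementary; the
    leading term is a combination of the integrals over R of 1/(1 + s^4) and
    s^2/(1 + s^4), both equal to pi/sqrt 2 ([half_angle_main]). *)

Set Implicit Arguments.
Unset Strict Implicit.
Unset Printing Implicit Defensive.

Import Order.TTheory GRing.Theory Num.Theory.
Import numFieldNormedType.Exports.
Local Open Scope classical_set_scope.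
Local Open Scope ring_scope.

(** * Change of variables and Fubini in the plane *)

Section product_sigma_finite.
Local Open Scope ereal_scope.
Context d1 d2 (T1 : measurableType d1) (T2 : measurableType d2) (R : realType).
Variables (m1 : {sigma_finite_measure set T1 -> \bar R})
  (m2 : {sigma_finite_measure set T2 -> \bar R}).

Lemma product_measure_sigma_finite : sigma_finite setT (m1 \x m2).
Proof.
have /sigma_finiteP[F [TF ndF Foo]] := sigma_finiteT m1.
have /sigma_finiteP[G [TG ndG Goo]] := sigma_finiteT m2.
exists (fun n => F n `*` G n).
  apply/seteqP; split => // -[x y] _.
  have [n _ Fnx] : (\bigcup_i F i) x by rewrite -TF.
  have [k _ Gky] : (\bigcup_i G i) y by rewrite -TG.
  exists (maxn n k) => //; split.
  - by move: x Fnx; exact/subsetPset/ndF/leq_maxl.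
  - by move: y Gky; exact/subsetPset/ndG/leq_maxr.
move=> k; have [? ?] := Foo k; have [? ?] := Goo k.
split; first exact: measurableX.
by rewrite product_measure1E// lte_mul_pinfty// ge0_fin_numE.
Qed.

End product_sigma_finite.

(** The measure [lebesgue2], packed with its sigma-finite structure, which
    Fubini's theorem on pairs of points of the plane asks for. *)
Definition leb2 {R : realType} :
    {sigma_finite_measure set (measurableTypeR R * measurableTypeR R)%type -> \bar R} :=
  HB.pack (@lebesgue_measure R \x @lebesgue_measure R)%E
    (@Measure_isSigmaFinite.Build _ _ _ (@lebesgue_measure R \x @lebesgue_measure R)%E
      (product_measure_sigma_finite (@lebesgue_measure R) (@lebesgue_measure R))).

Arguments leb2 {R} : simpl never.

Section affine.
Context {R : realType}.
Local Notation mu := (@lebesgue_measure R).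
Local Notation mu2 := (@leb2 R).

Lemma leb2_tonelli2 (F : R * R -> \bar R) : measurable_fun setT F -> (forall x, 0 <= F x)%E ->
  (\int[mu2]_x F x = \int[mu]_y \int[mu]_x F (x, y))%E.
Proof. by move=> mF F0; exact: (fubini_tonelli2 (m1 := mu) (m2 := mu)). Qed.

Lemma leb2_tonelli1 (F : R * R -> \bar R) : measurable_fun setT F -> (forall x, 0 <= F x)%E ->
  (\int[mu2]_x F x = \int[mu]_x \int[mu]_y F (x, y))%E.
Proof. by move=> mF F0; exact: (fubini_tonelli1 (m1 := mu) (m2 := mu)). Qed.

(** Lebesgue measure is the only measure with the right values on intervals,
    hence equals [a] times its image under the affine map. *)
Lemma ge0_integral_affine (a b : R) (f : R -> \bar R) : 0 < a ->
  measurable_fun setT f -> (forall x, 0 <= f x)%E ->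
  (a%:E * \int[mu]_x f (a * x + b)%R = \int[mu]_x f x)%E.
Proof.
move=> a0 mf f0.
have mh : measurable_fun setT (fun x : R => (a * x + b)%R : measurableTypeR R).
  by apply: measurable_funD => //; exact: measurable_funM.
pose m'_ : {measure set (measurableTypeR R) -> \bar R} :=
  mscale (NngNum (ltW a0)) (pushforward mu (fun x : R => (a * x + b)%R : measurableTypeR R)).
pose m' := m'_ mh.
have mE (A : set R) : measurable A -> mu A = m' A.
  move=> mA; apply: lebesgue_measure_unique => //= _ [[u v]] _ <-.
  rewrite /m' /m'_ /mscale/= /pushforward/=.
  have -> : (fun x : R => (a * x + b)%R) @^-1` `]u, v]%classic = `]((u - b) / a), ((v - b) / a)]%classic.
    apply/seteqP; split => x /=; rewrite !in_itv/= ltr_pdivrMr// ler_pdivlMr// (mulrC x) ltrBlDr lerBrDr//.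
  rewrite !lebesgue_measure_itv/= !lte_fin ltr_pM2r ?invr_gt0// ltrD2r.
  case: ifPn => uv; last by rewrite mule0.
  rewrite -!EFinB -EFinM; congr EFin; field; exact: lt0r_neq0.
transitivity (\int[m']_x f x)%E; last first.
  by apply: eq_measure_integral => A mA _; exact/esym/mE.
rewrite ge0_integral_mscale//=; congr (_ * _)%E.
have := @ge0_integral_pushforward _ _ (measurableTypeR R) (measurableTypeR R) R _ mh mu setT f measurableT mf (fun x _ => f0 x).
by rewrite preimage_setT => ->.
Qed.

(** [T] multiplies areas by [k], formulated for integrals; such maps compose,
    which reduces rotations and homotheties to shears. *)
Definition scales_area (k : R) (T : R * R -> R * R) := measurable_fun setT T /\
  forall F : R * R -> \bar R, measurable_fun setT F -> (forall x, 0 <= F x)%E ->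
  (k%:E * \int[mu2]_x F (T x) = \int[mu2]_x F x)%E.

Lemma scales_area_comp k1 k2 T1 T2 : scales_area k1 T1 -> scales_area k2 T2 ->
  scales_area (k1 * k2) (T1 \o T2).
Proof.
move=> [m1 h1] [m2 h2]; split; first exact: measurableT_comp.
move=> F mF F0 /=.
by rewrite EFinM -muleA (h2 (F \o T1)) ?h1//; [exact: measurableT_comp|move=> x; exact: F0].
Qed.

Lemma measurable_fun_fst2 : measurable_fun setT (fun x : R * R => x.1).
Proof. exact: measurable_fst. Qed.
Lemma measurable_fun_snd2 : measurable_fun setT (fun x : R * R => x.2).
Proof. exact: measurable_snd. Qed.
Hint Resolve measurable_fun_fst2 measurable_fun_snd2 : core.

(** For fixed second coordinate this is an affine map of the line, and Tonelli
    allows the first coordinate to be integrated first. *)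
Lemma scales_area_shear1 (a b c : R) : 0 < a ->
  scales_area a (fun x => (a * x.1 + (b * x.2 + c), x.2)).
Proof.
move=> a0.
have mT : measurable_fun setT (fun x : R * R => (a * x.1 + (b * x.2 + c), x.2)).
  apply/measurable_fun_pairP; split => //=.
  by apply: measurable_funD; [exact: measurable_funM|apply: measurable_funD => //; exact: measurable_funM].
split => // F mF F0.
have mF' : measurable_fun setT (fun x : R * R => F (a * x.1 + (b * x.2 + c), x.2)) by exact: measurableT_comp mF mT.
rewrite (leb2_tonelli2 mF)// leb2_tonelli2//.
rewrite -ge0_integralZl//; last 3 first.
- by apply: (@measurable_fun_fubini_tonelli_G _ _ _ _ R mu _ mF') => z; exact: F0.
- by move=> y _; exact: integral_ge0.
- by rewrite lee_fin ltW.
apply: eq_integral => y _ /=.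
apply: (@ge0_integral_affine a (b * y + c) (fun x => F (x, y))) => //.
exact: measurableT_comp.
Qed.

Lemma scales_area_shear2 (a b c : R) : 0 < a ->
  scales_area a (fun x => (x.1, a * x.2 + (b * x.1 + c))).
Proof.
move=> a0.
have mT : measurable_fun setT (fun x : R * R => (x.1, a * x.2 + (b * x.1 + c))).
  apply/measurable_fun_pairP; split => //=.
  by apply: measurable_funD; [exact: measurable_funM|apply: measurable_funD => //; exact: measurable_funM].
split => // F mF F0.
have mF' : measurable_fun setT (fun x : R * R => F (x.1, a * x.2 + (b * x.1 + c))) by exact: measurableT_comp mF mT.
rewrite (leb2_tonelli1 mF)// leb2_tonelli1//.
rewrite -ge0_integralZl//; last 3 first.
- by apply: (@measurable_fun_fubini_tonelli_F _ _ _ _ R mu _ mF') => z; exact: F0.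
- by move=> y _; exact: integral_ge0.
- by rewrite lee_fin ltW.
apply: eq_integral => y _ /=.
apply: (@ge0_integral_affine a (b * y + c) (fun x => F (y, x))) => //.
exact: measurableT_comp.
Qed.

(** The rotation by an angle with cosine [c] and sine [s], which keeps all
    computations with rotations algebraic. *)
Definition rotation (c s : R) (x : R * R) : R * R := (c * x.1 - s * x.2, s * x.1 + c * x.2).

(** A rotation with [s != 0] is the product of three shears, with coefficients
    (c-1)/s, s, (c-1)/s. The half-turn is the square of the quarter-turn. *)
Lemma scales_area_rotation (c s : R) : c ^+ 2 + s ^+ 2 = 1 -> scales_area 1 (rotation c s).
Proof.
have main c' s' : c' ^+ 2 + s' ^+ 2 = 1 -> s' != 0 -> scales_area 1 (rotation c' s').
  move=> cs s0.
  pose k := (c' - 1) / s'.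
  have := scales_area_comp (@scales_area_shear1 1 k 0 ltr01)
     (scales_area_comp (@scales_area_shear2 1 s' 0 ltr01) (@scales_area_shear1 1 k 0 ltr01)).
  rewrite !mul1r; congr scales_area; apply/funext => -[x y]; rewrite /rotation/= /k.
  congr pair; last by field.
  have -> : c' * x - s' * y = c' * x - (s' ^+ 2 * y) / s' by field.
  have -> : s' ^+ 2 = 1 - c' ^+ 2 by rewrite -cs; ring.
  by field.
move=> cs; have [s0|s0] := eqVneq s 0; last exact: main.
have /eqP : c ^+ 2 = 1 by rewrite -cs s0 expr0n addr0.
rewrite sqrf_eq1 => /orP[] /eqP c1.
  split => [|F mF F0].
    rewrite (_ : rotation _ _ = id); first exact: measurable_id.
    by apply/funext => -[x y]; rewrite /rotation s0 c1/=; congr pair; ring.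
  rewrite mul1e; apply: eq_integral => -[x y] _; rewrite /rotation s0 c1/=; congr (F (_, _)); ring.
have h : scales_area 1 (rotation 0 1) by apply: main; rewrite ?oner_neq0// expr0n expr1n add0r.
have := scales_area_comp h h; rewrite mul1r; congr scales_area; apply/funext => -[x y].
by rewrite /rotation s0 c1/=; congr pair; ring.
Qed.

Lemma scales_area_homothety (a b1 b2 : R) : 0 < a ->
  scales_area (a ^+ 2) (fun x => (a * x.1 + b1, a * x.2 + b2)).
Proof.
move=> a0; have := scales_area_comp (@scales_area_shear1 a 0 b1 a0) (@scales_area_shear2 a 0 b2 a0).
by rewrite -expr2; congr scales_area; apply/funext => x /=; congr pair; ring.
Qed.

(** As [k] is positive and finite, it changes neither infinities nor
    indeterminate forms; used to rescale an integral given as the difference of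
    its positive and negative parts. *)
Lemma gt0_muleBr (k : R) (a b : \bar R) : 0 < k ->
  (k%:E * (a - b) = k%:E * a - k%:E * b)%E.
Proof.
move=> k0; case: a b => [a| |] [b| |] //=;
  rewrite ?(gt0_muley, gt0_muleNy) ?lte_fin//= ?(gt0_muley, gt0_muleNy) ?lte_fin//.
by rewrite -EFinD -!EFinM -EFinD mulrDr mulrN.
Qed.

Lemma scales_area_integrable (k : R) T (F : R * R -> R) : 0 < k -> scales_area k T ->
  mu2.-integrable setT (EFin \o F) -> mu2.-integrable setT (EFin \o (F \o T)).
Proof.
move=> k0 [mT hT] /integrableP[mF iF]; apply/integrableP; split.
  exact: measurableT_comp mF mT.
have := hT (abse \o (EFin \o F)) (measurableT_comp (@abse_measurable _ _) mF) (fun x => abse_ge0 _).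
rewrite /= => h; move: iF; rewrite /= -h.
rewrite -lte_pdivlMl// => /lt_le_trans; apply.
exact: leey.
Qed.

Lemma scales_area_Rintegral (k : R) T (F : R * R -> R) : 0 < k -> scales_area k T ->
  measurable_fun setT F ->
  k * (\int[mu2]_x F (T x)) = \int[mu2]_x F x.
Proof.
move=> k0 [mT hT] mF.
rewrite /Rintegral; have mF' : measurable_fun setT (EFin \o F) by exact/measurable_EFinP.
have -> : (\int[mu2]_x (F x)%:E = k%:E * \int[mu2]_x (F (T x))%:E)%E.
  have hp := hT _ (measurable_funepos mF') (fun x => funepos_ge0 _ x).
  have hn := hT _ (measurable_funeneg mF') (fun x => funeneg_ge0 _ x).
  rewrite (integralE mu2 setT (EFin \o F)) (integralE mu2 setT (EFin \o (F \o T))).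
  rewrite -hp -hn; apply/esym.
  rewrite (gt0_muleBr _ _ k0); congr (_ * _ - _ * _)%E; apply: eq_integral => x _.
    by rewrite -[RHS]/(((EFin \o F)^\+%E \o T) x) -funepos_comp.
  by rewrite -[RHS]/(((EFin \o F)^\-%E \o T) x) -funeneg_comp.
by case: (\int[mu2]_x (F (T x))%:E)%E => [r| |] //=; rewrite ?gt0_muley ?gt0_muleNy ?lte_fin//= mulr0.
Qed.

End affine.

(** The direction of a vector is defined only away from the origin; this lemma
    discards the origin. *)
Lemma eq_Rintegral_off_null d (T : measurableType d) (R : realType)
    (m : {measure set T -> \bar R}) (N : set T) (f g : T -> R) :
  measurable N -> m N = 0%E -> measurable_fun setT f -> measurable_fun setT g ->
  (forall x, ~ N x -> f x = g x) -> \int[m]_x f x = \int[m]_x g x.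
Proof.
move=> mN N0 mf mg fg; congr fine; apply: ae_eq_integral => //; [exact/measurable_EFinP|exact/measurable_EFinP|].
by exists N; split => // x /= /not_implyP[_ h]; apply: contrapT => /fg fgx; apply: h; rewrite fgx.
Qed.

Section Rfubini.
Context d1 d2 (T1 : measurableType d1) (T2 : measurableType d2) (R : realType).
Variables (m1 : {sigma_finite_measure set T1 -> \bar R})
  (m2 : {sigma_finite_measure set T2 -> \bar R}).

Lemma integrable_prodM (a : T1 -> R) (b : T2 -> R) (c : T1 * T2 -> R) :
  m1.-integrable setT (EFin \o a) -> m2.-integrable setT (EFin \o b) ->
  measurable_fun setT c -> (forall z, `|c z| <= 1) ->
  (m1 \x m2)%E.-integrable setT (EFin \o (fun z => a z.1 * b z.2 * c z)).
Proof.
move=> ia ib mc c1.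
have ma : measurable_fun setT a by apply/measurable_EFinP/(measurable_int m1).
have mb : measurable_fun setT b by apply/measurable_EFinP/(measurable_int m2).
apply/integrable12ltyP.
  apply/measurable_EFinP; apply: measurable_funM => //.
  by apply: measurable_funM; exact: measurableT_comp.
apply: (@le_lt_trans _ _ (\int[m1]_x (`|(a x)%:E| * \int[m2]_y `|(b y)%:E|))%E).
  apply: ge0_le_integral => //.
  - move=> x _; exact: integral_ge0.
  - apply: (@measurable_fun_fubini_tonelli_F _ _ _ _ R m2 (fun z => `|(a z.1 * b z.2 * c z)%:E|)%E) => //.
    apply: measurableT_comp => //; apply/measurable_EFinP; apply: measurable_funM => //.
    by apply: measurable_funM; exact: measurableT_comp.
  - apply: emeasurable_funM => //; apply: measurableT_comp => //; exact/measurable_EFinP.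
  - move=> x _; rewrite -ge0_integralZl//; last first.
      by apply: measurableT_comp => //; exact/measurable_EFinP.
    apply: ge0_le_integral => //.
    + apply: measurableT_comp => //; apply/measurable_EFinP; apply: measurable_funM.
        by apply: measurable_funM => //; exact: measurableT_comp.
      exact: measurableT_comp.
    + apply: measurable_funeM; apply: measurableT_comp => //; exact/measurable_EFinP.
    + move=> y _; rewrite -abseM abse_EFin lee_fin /= [leLHS]normrM.
      by rewrite ler_piMr.
rewrite ge0_integralZr//; last 2 first.
- by apply: measurableT_comp => //; exact/measurable_EFinP.
- exact: integral_ge0.
move/integrableP : ia => [_ ia]; move/integrableP : ib => [_ ib].
by rewrite lte_mul_pinfty// ?integral_ge0// ge0_fin_numE// integral_ge0.
Qed.

Variable F : T1 * T2 -> R.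
Hypothesis iF : (m1 \x m2)%E.-integrable setT (EFin \o F).

Lemma measurable_Rint1 : (forall y, m1.-integrable setT (fun x => (F (x, y))%:E)) ->
  measurable_fun setT (fun y => \int[m1]_x F (x, y)).
Proof.
move=> i1; apply/measurable_EFinP.
apply: eq_measurable_fun (measurable_fubini_G iF) => y _.
by rewrite /fubini_G /Rintegral/= fineK//; exact: integrable_fin_num.
Qed.

Lemma Rintegral_fubini12 : (forall x, m2.-integrable setT (fun y => (F (x, y))%:E)) ->
  \int[m1]_x \int[m2]_y F (x, y) = \int[(m1 \x m2)%E]_z F z.
Proof.
move=> i2; rewrite /Rintegral -(integral12_prod_meas1 iF); congr fine.
apply: eq_integral => x _.
by rewrite fineK//; exact: integrable_fin_num.
Qed.

Lemma Rintegral_fubini21 : (forall y, m1.-integrable setT (fun x => (F (x, y))%:E)) ->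
  \int[m2]_y \int[m1]_x F (x, y) = \int[(m1 \x m2)%E]_z F z.
Proof.
move=> i2; rewrite /Rintegral -(integral21_prod_meas1 iF); congr fine.
apply: eq_integral => x _.
by rewrite fineK//; exact: integrable_fin_num.
Qed.

End Rfubini.

(** * Integrals over the line *)

Section calculus.
Context {R : realType}.
Local Notation mu := (@lebesgue_measure R).

Lemma is_derive1_continuous (F : R -> R) (x d : R) : is_derive x 1 F d -> {for x, continuous F}.
Proof. by move=> [dF _]; exact/differentiable_continuous/derivable1_diffP. Qed.

Lemma Rintegral_FTC (f F : R -> R) (a b : R) : a < b ->
  (forall x, a <= x <= b -> is_derive x 1 F (f x)) -> {within `[a, b], continuous f} ->
  \int[mu]_(x in `[a, b]) f x = F b - F a.
Proof.
move=> ab dF cf; rewrite /Rintegral (@continuous_FTC2 _ f F)//.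
- split.
  + by move=> x /[!in_itv]/= /andP[ax xb]; apply: (@ex_derive _ _ _ _ _ _ _ (dF x _)); rewrite !ltW.
  + by apply: cvg_at_right_filter; apply: (is_derive1_continuous (dF a _)); rewrite lexx ltW.
  + by apply: cvg_at_left_filter; apply: (is_derive1_continuous (dF b _)); rewrite lexx ltW.
- by move=> x /[!in_itv]/= /andP[ax xb]; rewrite derive1E; apply: (@derive_val _ _ _ _ _ _ _ (dF x _)); rewrite !ltW.
Qed.

Lemma ge0_integral_FTCy (f F : R -> R) (a l : R) :
  (forall x, a <= x -> is_derive x 1 F (f x)) -> (forall x, a <= x -> 0 <= f x) ->
  continuous f -> F x @[x --> +oo%R] --> l ->
  (\int[mu]_(x in `[a, +oo[) (f x)%:E = (l - F a)%:E)%E.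
Proof.
move=> dF f0 cf Fl; rewrite (@ge0_continuous_FTC2y _ f F a l)//.
- exact: continuous_subspaceT.
- by move=> x ax; apply: (@ex_derive _ _ _ _ _ _ _ (dF x _)); rewrite !ltW.
- by apply: cvg_at_right_filter; apply: (is_derive1_continuous (dF a _)); rewrite lexx.
- by move=> x /[!in_itv]/=; rewrite andbT => ax; rewrite derive1E; apply: (@derive_val _ _ _ _ _ _ _ (dF x _)); rewrite !ltW.
Qed.

(** Nonnegativity spares a separate proof that the integrand is integrable. *)
Lemma ge0_even_integral_FTC (f F : R -> R) (l : R) :
  (forall x : R, 0 <= x -> is_derive x 1 F (f x)) -> (forall x, 0 <= f x) -> (forall x, f (- x) = f x) ->
  continuous f -> F x @[x --> +oo%R] --> l ->
  (\int[mu]_x (f x)%:E = (2 * (l - F 0))%:E)%E.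
Proof.
move=> dF f0 fN cf Fl; rewrite ge0_symfun_integralT//; last by move=> x /=; rewrite fN.
rewrite (_ : [set x | _] = `[0, +oo[%classic); last first.
  by apply/seteqP; split => x/=; rewrite in_itv/= andbT.
by rewrite (ge0_integral_FTCy dF _ cf Fl)//.
Qed.

Lemma integral_gauss_scaled (c : R) : 0 < c ->
  (\int[mu]_x (expR (- (c * x ^+ 2)))%:E = (Num.sqrt (pi / c))%:E)%E.
Proof.
move=> c0; have sc0 : 0 < Num.sqrt c by rewrite sqrtr_gt0.
have := @ge0_integral_affine R (Num.sqrt c) 0 (fun x => (gauss_fun x)%:E) sc0 _ (fun x => _).
rewrite integralT_gauss => h.
have {}h : ((Num.sqrt c)%:E * \int[mu]_x (expR (- (c * x ^+ 2)))%:E = (Num.sqrt pi)%:E)%E.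
  rewrite -h; first by congr (_ * _)%E; apply: eq_integral => x _; rewrite /gauss_fun addr0 exprMn sqr_sqrtr// ltW.
  by apply/measurable_EFinP; exact: measurable_gauss_fun.
  by move=> ?; rewrite lee_fin gauss_fun_ge0.
have -> : Num.sqrt (pi / c) = (Num.sqrt c)^-1 * Num.sqrt pi :> R.
  by rewrite sqrtrM ?pi_ge0// sqrtrV ?ltW// mulrC.
by rewrite EFinM -h muleA -EFinM mulVf ?mul1e// gt_eqF.
Qed.

Lemma continuous_oneDX4V : continuous (fun x : R => (1 + x ^+ 4)^-1).
Proof.
move=> x; apply: cvgV; first by rewrite gt_eqF// ltr_pwDl// -[x^+4]/(x^+(2*2)) exprM sqr_ge0.
apply: cvgD; [exact: cvg_cst|exact: exprn_continuous].
Qed.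

Lemma oneDX4_gt0 (x : R) : 0 < 1 + x ^+ 4.
Proof. by rewrite ltr_pwDl// -[x^+4]/(x^+(2*2)) exprM sqr_ge0. Qed.

Let q : R := Num.sqrt 2.
Let q2 : q ^+ 2 = 2. Proof. by rewrite sqr_sqrtr. Qed.
Let q0 : 0 < q. Proof. by rewrite sqrtr_gt0. Qed.

(** Primitives of (1 + x^2)/(1 + x^4) and of (x^2 - 1)/(1 + x^4), from the
    factorization of 1 + x^4 into two quadratic polynomials; their half-sum and
    half-difference are primitives of x^2/(1 + x^4) and 1/(1 + x^4). *)
Definition atan_part (x : R) := q^-1 * (atan (q * x + 1) + atan (q * x - 1)).
Definition ln_part (x : R) := (2 * q)^-1 * (ln (x ^+ 2 - q * x + 1) - ln (x ^+ 2 + q * x + 1)).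

Let pos1 x : 0 < x ^+ 2 - q * x + 1.
Proof. have := q2; have := sqr_ge0 (2 * x - q); nra. Qed.
Let pos2 x : 0 < x ^+ 2 + q * x + 1.
Proof. have := q2; have := sqr_ge0 (2 * x + q); nra. Qed.

Let posM x : (x ^+ 2 - q * x + 1) * (x ^+ 2 + q * x + 1) = 1 + x ^+ 4.
Proof.
transitivity (1 + x ^+ 4 + (2 - q ^+ 2) * x ^+ 2); first by ring.
by rewrite q2 subrr mul0r addr0.
Qed.

Lemma derive_atan_part (x : R) : is_derive x 1 atan_part ((1 + x ^+ 2) / (1 + x ^+ 4)).
Proof.
rewrite /atan_part; apply: is_derive_eq.
rewrite /GRing.scale/=.
have -> : 1 + (q * x + 1) ^+ 2 = 2 * (x ^+ 2 + q * x + 1).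
  transitivity (q ^+ 2 * x ^+ 2 + 2 * q * x + 2); first by ring.
  by rewrite q2; ring.
have -> : 1 + (q * x - 1) ^+ 2 = 2 * (x ^+ 2 - q * x + 1).
  transitivity (q ^+ 2 * x ^+ 2 - 2 * q * x + 2); first by ring.
  by rewrite q2; ring.
rewrite -posM; field.
by rewrite !gt_eqF.
Qed.

Lemma derive_ln_part (x : R) : is_derive x 1 ln_part ((x ^+ 2 - 1) / (1 + x ^+ 4)).
Proof.
rewrite /ln_part.
have := is_derive1_ln (pos1 x) => d1.
have := is_derive1_ln (pos2 x) => d2.
apply: is_derive_eq.
rewrite /GRing.scale/= -posM; field.
by rewrite !gt_eqF.
Qed.

Lemma cvg_atan_part : atan_part x @[x --> +oo] --> q^-1 * pi.
Proof.
rewrite /atan_part; apply: cvgM; first exact: cvg_cst.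
rewrite (_ : pi = pi / 2 + pi / 2); last by field.
have h (c : R) : q * x + c @[x --> +oo] --> +oo.
  apply/cvgryPge => A; near=> x.
  rewrite -lerBlDr -ler_pdivrMl//; near: x; apply: nbhs_pinfty_ge; exact: num_real.
apply: cvgD; [apply: cvg_comp (h 1) _| apply: cvg_comp (h (- 1)) _]; exact: cvgy_atan.
Unshelve. all: by end_near. Qed.

Lemma cvg_ln_part : ln_part x @[x --> +oo] --> (0 : R).
Proof.
have h : ((x ^+ 2 - q * x + 1) / (x ^+ 2 + q * x + 1)) @[x --> +oo] --> (1 : R).
  apply/cvgrPdist_le => e e0; near=> x.
  have x1 : 1 <= x by near: x; apply: nbhs_pinfty_ge; exact: num_real.
  have xe : 2 * q / e <= x by near: x; apply: nbhs_pinfty_ge; exact: num_real.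
  rewrite (_ : 1 - _ = 2 * q * x / (x ^+ 2 + q * x + 1)); last by field; exact: lt0r_neq0.
  rewrite ger0_norm; last by rewrite divr_ge0 ?(ltW (pos2 x))// !mulr_ge0 ?ltW// (lt_le_trans _ x1).
  rewrite ler_pdivrMr//; rewrite ler_pdivrMr// in xe.
  have := q0; nra.
have : ln ((x ^+ 2 - q * x + 1) / (x ^+ 2 + q * x + 1)) @[x --> +oo] --> (0 : R).
  rewrite -ln1; apply: (continuous_cvg _ _ h); exact: continuous_ln.
move=> h2; rewrite -(mulr0 (2 * q)^-1); apply: cvgM; first exact: cvg_cst.
apply: cvg_trans h2; apply: near_eq_cvg; apply: nearW => x.
by rewrite ln_div// posrE.
Unshelve. all: by end_near. Qed.

Lemma atan_part0 : atan_part 0 = 0.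
Proof. by rewrite /atan_part mulr0 add0r sub0r atanN addrN mulr0. Qed.
Lemma ln_part0 : ln_part 0 = 0.
Proof. by rewrite /ln_part mulr0 expr0n/= subr0 addr0 subrr mulr0. Qed.

Lemma integral_oneDX4V : (\int[mu]_x ((1 + x ^+ 4)^-1)%:E = (pi / Num.sqrt 2)%:E)%E.
Proof.
have dF (x : R) : 0 <= x -> is_derive x 1 (fun x => 2^-1 * (atan_part x - ln_part x)) ((fun x : R => (1 + x ^+ 4)^-1) x).
  move=> _; have := derive_atan_part x; have := derive_ln_part x => d1 d2.
  apply: is_derive_eq; rewrite /GRing.scale/=; field; exact/lt0r_neq0/oneDX4_gt0.
rewrite (ge0_even_integral_FTC (l := 2^-1 * (q^-1 * pi - 0)) dF).
- rewrite atan_part0 ln_part0 /=; congr EFin; rewrite -/q; field; exact: lt0r_neq0.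
- by move=> x; rewrite invr_ge0 ltW// oneDX4_gt0.
- by move=> x; congr (_^-1); ring.
- exact: continuous_oneDX4V.
- apply: cvgM; first exact: cvg_cst.
  by apply: cvgB; [exact: cvg_atan_part|exact: cvg_ln_part].
Qed.

Lemma integral_X2oneDX4V : (\int[mu]_x (x ^+ 2 / (1 + x ^+ 4))%:E = (pi / Num.sqrt 2)%:E)%E.
Proof.
have dF (x : R) : 0 <= x -> is_derive x 1 (fun x => 2^-1 * (atan_part x + ln_part x)) ((fun x : R => x ^+ 2 / (1 + x ^+ 4)) x).
  move=> _; have := derive_atan_part x; have := derive_ln_part x => d1 d2.
  apply: is_derive_eq; rewrite /GRing.scale/=; field; exact/lt0r_neq0/oneDX4_gt0.
rewrite (ge0_even_integral_FTC (l := 2^-1 * (q^-1 * pi + 0)) dF).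
- rewrite atan_part0 ln_part0 /=; congr EFin; rewrite -/q; field; exact: lt0r_neq0.
- by move=> x; rewrite mulr_ge0 ?sqr_ge0// invr_ge0 ltW// oneDX4_gt0.
- by move=> x; congr (_ * _^-1); ring.
- by move=> x; apply: cvgM; [exact: exprn_continuous|exact: continuous_oneDX4V].
- apply: cvgM; first exact: cvg_cst.
  by apply: cvgD; [exact: cvg_atan_part|exact: cvg_ln_part].
Qed.

End calculus.

(** * Asymptotics of the Bessel function *)

Section bessel.
Context {R : realType}.
Local Notation mu := (@lebesgue_measure R).

(** The Bessel function J_0. *)
Definition bessel (t : R) : R := 2 / pi * \int[mu]_(a in `[0, pi / 2]) cos (t * cos a).

(** The derivative of sin(t cos a) is -t sin a cos(t cos a), and this function
    is (1 - cos(a/2))/sin a, with the common factor sin(a/2) cancelled so that it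
    is smooth up to a = 0. *)
Definition phase_weight (a : R) := sin (a / 2) / (2 * cos (a / 2) * (1 + cos (a / 2))).
Definition dphase_weight (a : R) := (2^-1 * cos (a / 2) * (2 * cos (a / 2) * (1 + cos (a / 2)))
   + sin (a / 2) * (sin (a / 2) * (1 + cos (a / 2)) + cos (a / 2) * sin (a / 2)))
  / (2 * cos (a / 2) * (1 + cos (a / 2))) ^+ 2.

Lemma sin_half (a : R) : sin a = 2 * sin (a / 2) * cos (a / 2).
Proof.
have e : a = a / 2 + a / 2 by field.
by rewrite [in LHS]e sinD; ring.
Qed.

Lemma cos_half (a : R) : cos a = 1 - 2 * sin (a / 2) ^+ 2.
Proof.
have e : a = a / 2 + a / 2 by field.
by rewrite [in LHS]e cosD -!expr2 cos2sin2; ring.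
Qed.

Let halfcos (a : R) : 0 <= a <= pi / 2 -> 2^-1 <= cos (a / 2).
Proof.
move=> /andP[a0 ap].
have h1 : cos a = 2 * cos (a / 2) ^+ 2 - 1 by rewrite cos_half sin2cos2; ring.
have c0 : 0 <= cos a by apply: cos_ge0_pihalf; rewrite ap andbT (le_trans _ a0)// oppr_le0 divr_ge0 ?pi_ge0.
have c2 : 0 <= cos (a / 2).
  apply: cos_ge0_pihalf; apply/andP; split; first by rewrite (@le_trans _ _ 0) ?oppr_le0 ?divr_ge0 ?pi_ge0.
  by rewrite ler_pM2r ?invr_gt0// (le_trans ap)// ler_pdivrMr// ler_peMr ?pi_ge0// ler1n.
nra.
Qed.

Lemma derive_phase_weight (a : R) : 0 <= a <= pi / 2 -> is_derive a 1 phase_weight (dphase_weight a).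
Proof.
move=> /halfcos h.
have c0 : 0 < cos (a / 2) by apply: lt_le_trans h.
have D0 : 2 * cos (a / 2) * (1 + cos (a / 2)) != 0 by rewrite gt_eqF// !mulr_gt0// addr_gt0.
rewrite /phase_weight; apply: is_derive_eq.
rewrite /dphase_weight /GRing.scale/=.
field.
by rewrite !gt_eqF ?addr_gt0.
Qed.

Lemma continuous_dphase_weight (a : R) : 0 <= a <= pi / 2 -> {for a, continuous dphase_weight}.
Proof.
move=> /halfcos h.
have c0 : 0 < cos (a / 2) by apply: lt_le_trans h.
have D0 : 2 * cos (a / 2) * (1 + cos (a / 2)) != 0 by rewrite gt_eqF// !mulr_gt0// addr_gt0.
have cn : {for a, continuous (fun a : R => 2^-1 * cos (a / 2) * (2 * cos (a / 2) * (1 + cos (a / 2)))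
   + sin (a / 2) * (sin (a / 2) * (1 + cos (a / 2)) + cos (a / 2) * sin (a / 2)))}.
  by apply: is_derive1_continuous.
have cd : {for a, continuous (fun a : R => (2 * cos (a / 2) * (1 + cos (a / 2))) ^+ 2)}.
  by apply: is_derive1_continuous.
by apply: cvgM; [exact: cn|apply: cvgV; [rewrite sqrf_eq0|exact: cd]].
Qed.

Lemma dphase_weight_le (a : R) : 0 <= a <= pi / 2 -> `|dphase_weight a| <= 5.
Proof.
move=> /halfcos h.
have c1 := cos_le1 (a / 2).
have s2 : sin (a / 2) ^+ 2 = 1 - cos (a / 2) ^+ 2 by exact: sin2cos2.
rewrite /dphase_weight.
set c := cos _ in h c1 s2 *; set s := sin _ in s2 *.
have d1 : 1 <= (2 * c * (1 + c)) ^+ 2 by rewrite exprn_ege1//; nra.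
rewrite normf_div ler_pdivrMr; last by rewrite normr_gt0 gt_eqF// (lt_le_trans _ d1).
rewrite [X in _ <= _ * X]ger0_norm ?sqr_ge0//.
have -> : 2^-1 * c * (2 * c * (1 + c)) + s * (s * (1 + c) + c * s) = c ^+ 2 * (1 + c) + s ^+ 2 * (1 + 2 * c) by field.
rewrite s2 ger0_norm; last by nra.
by apply: (@le_trans _ _ 5); nra.
Qed.

(** Integration by parts of cos(t cos a) (1 - cos(a/2)), at the level of
    derivatives. *)
Lemma integrate_phase (t a : R) : 0 < t -> 0 <= a <= pi / 2 ->
   is_derive a 1 (fun a => - (phase_weight a * sin (t * cos a)) / t)
    (cos (t * cos a) * (1 - cos (a / 2)) - dphase_weight a * sin (t * cos a) / t).
Proof.
move=> t0 h; have := derive_phase_weight h => d.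
have := halfcos h => h2.
apply: is_derive_eq.
rewrite /GRing.scale/= /phase_weight.
rewrite (sin_half a).
have s2 : sin (a / 2) ^+ 2 = 1 - cos (a / 2) ^+ 2 by exact: sin2cos2.
have c0 : 0 < cos (a / 2) by apply: lt_le_trans h2.
set c := cos (a / 2) in c0 s2 *; set s := sin (a / 2) in s2 *.
set C := cos (t * _); set S := sin (t * _); set D := dphase_weight _.
transitivity (C * (s ^+ 2 / (1 + c)) - D * S / t).
  by field; rewrite !gt_eqF// addr_gt0.
rewrite s2; field; by rewrite !gt_eqF// addr_gt0.
Qed.

Let D0 : (0 : R) < pi / 2. Proof. by rewrite divr_gt0// pi_gt0. Qed.

Lemma continuous_costcos (t : R) : continuous (fun a : R => cos (t * cos a)).
Proof. by move=> a; apply: is_derive1_continuous. Qed.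

Lemma continuous_sintcos (t : R) : continuous (fun a : R => sin (t * cos a)).
Proof. by move=> a; apply: is_derive1_continuous. Qed.

Lemma integrable_continuous (f : R -> R) (a b : R) : {within `[a, b], continuous f} ->
  mu.-integrable `[a, b] (EFin \o f).
Proof. by move=> cf; apply: continuous_compact_integrable => //; exact: segment_compact. Qed.

Lemma integrable_continuous_oc (f : R -> R) (a b : R) : continuous f ->
  mu.-integrable `]a, b] (EFin \o f).
Proof.
move=> cf; have := @integrableS _ _ _ mu `[a, b]%classic `]a, b]%classic (EFin \o f).
apply; [exact: measurable_itv|exact: measurable_itv|exact: subset_itv_oc_cc|].
by apply: integrable_continuous; exact: continuous_subspaceT.
Qed.

(** The boundary terms vanish, at [pi/2] because sin(t cos a) does and at [0]
    because the weight does. *)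
Lemma half_angle_remainder (t : R) : 0 < t ->
  `|\int[mu]_(a in `[0, pi / 2]) (cos (t * cos a) * (1 - cos (a / 2)))| <= 5 * (pi / 2) / t.
Proof.
move=> t0.
have cA' : continuous (fun a : R => cos (t * cos a) * (1 - cos (a / 2))) by move=> a; apply: is_derive1_continuous.
have cA : {within `[0, pi / 2], continuous (fun a : R => cos (t * cos a) * (1 - cos (a / 2)))}.
  by apply: continuous_subspaceT => a; exact: cA'.
have cB' a : 0 <= a <= pi / 2 -> {for a, continuous (fun a : R => dphase_weight a * sin (t * cos a) / t)}.
  move=> h; apply: cvgM; last exact: cvg_cst.
  by apply: cvgM; [exact: continuous_dphase_weight|exact: continuous_sintcos].
have cB : {within `[0, pi / 2], continuous (fun a : R => dphase_weight a * sin (t * cos a) / t)}.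
  by apply: continuous_in_subspaceT => a; rewrite inE/= in_itv/= => h; exact: cB'.
have E := Rintegral_FTC D0 (fun x => @integrate_phase t x t0) _.
have {}E : \int[mu]_(a in `[0, pi / 2]) (cos (t * cos a) * (1 - cos (a / 2))) =
    \int[mu]_(a in `[0, pi / 2]) (dphase_weight a * sin (t * cos a) / t).
  apply/eqP; rewrite -subr_eq0 -RintegralB//; [|exact: integrable_continuous|exact: integrable_continuous].
  rewrite E.
    by rewrite cos_pihalf mulr0 sin0 mulr0 oppr0 mul0r /phase_weight mul0r sin0 mul0r mul0r oppr0 mul0r subr0.
  apply: continuous_in_subspaceT => a; rewrite inE/= in_itv/= => h.
  by apply: cvgB; [exact: cA'|exact: cB'].
rewrite E.
apply: (le_trans (le_normr_Rintegral _ _)) => //; first exact: integrable_continuous.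
have -> : 5 * (pi / 2) / t = \int[mu]_(a in `[0, pi / 2]) (5 / t) :> R.
  rewrite Rintegral_cst//= lebesgue_measure_itv/= lte_fin D0/= subr0; ring.
apply: le_Rintegral => //.
- exact/integrable_norm/integrable_continuous.
- by apply: integrable_continuous; apply: continuous_subspaceT => ?; exact: cvg_cst.
- move=> a; rewrite /= in_itv/= => h.
  rewrite normrM (@ger0_norm _ t^-1) ?invr_ge0 ?(ltW t0)// ler_pM2r ?invr_gt0// normrM.
  by rewrite -[5]mulr1 ler_pM// ?dphase_weight_le// sin_max.
Qed.

Let D : set R := `]0, pi / 2]%classic.

(** The integrand on [0, pi/2] x R whose two iterated integrals are compared. *)
Definition gauss_phase (t : R) (z : R * R) : R :=
  \1_D z.1 * (sin z.1 * expR (- (t * (1 - cos z.1) * z.2 ^+ 2)) * cos (t * cos z.1)).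

(** Gaussian integral with parameter t (1 - cos a) = 2 t sin^2(a/2), while
    sin a = 2 sin(a/2) cos(a/2): the factor sin(a/2) cancels. *)
Lemma gauss_phase_inner (t a : R) : 0 < t -> a \in `]0, pi / 2] ->
  (\int[mu]_s (sin a * expR (- (t * (1 - cos a) * s ^+ 2)))%:E = (Num.sqrt (2 * pi / t) * cos (a / 2))%:E)%E.
Proof.
move=> t0; rewrite in_itv/= => /andP[a0 ap].
have h1 := cos_half a.
have h2 := sin_half a.
have s0 : 0 < sin (a / 2).
  apply: sin_gt0_pihalf; rewrite divr_gt0//= ltr_pM2r ?invr_gt0// (le_lt_trans ap)// ltr_pdivrMr// ltr_pMr ?pi_gt0// ltr1n//.
have c0 : 0 <= cos (a / 2).
  by have /halfcos : 0 <= a <= pi / 2 by [rewrite ltW|]; apply: le_trans.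
have v0 : 0 < t * (1 - cos a).
  by rewrite mulr_gt0// h1 opprB addrCA subrr addr0 mulr_gt0// exprn_gt0.
under eq_integral do rewrite EFinM.
rewrite ge0_integralZl//; last 2 first.
- apply/measurable_EFinP; apply: measurableT_comp => //; apply: measurableT_comp => //; exact: measurable_funM.
- by rewrite lee_fin h2 !mulr_ge0// ltW.
rewrite integral_gauss_scaled// -EFinM; congr EFin.
rewrite h1 opprB addrCA subrr addr0.
rewrite (_ : pi / (t * (2 * sin (a / 2) ^+ 2)) = (2 * pi / t) * (2 * sin (a / 2)) ^- 2); last first.
  by field; rewrite !gt_eqF//.
rewrite sqrtrM ?divr_ge0 ?mulr_ge0 ?pi_ge0 ?(ltW t0)// -exprVn sqrtr_sqr ger0_norm ?invr_ge0 ?mulr_ge0 ?ltW//.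
rewrite h2; field; exact: lt0r_neq0.
Qed.

Lemma measurable_gauss_phase t : measurable_fun setT (gauss_phase t).
Proof.
apply: measurable_funM.
  by apply: (measurableT_comp _ measurable_fst); apply: measurable_indic; exact: measurable_itv.
apply: measurable_funM.
  apply: measurable_funM.
    by apply: (measurableT_comp _ measurable_fst); apply: continuous_measurable_fun; exact: continuous_sin.
  apply: measurableT_comp => //; apply: measurableT_comp => //.
  apply: measurable_funM; last by apply: measurable_funX; exact: measurable_snd.
  apply: measurable_funM => //; apply: measurable_funB => //.
  by apply: (measurableT_comp _ measurable_fst); apply: continuous_measurable_fun; exact: continuous_cos.
exact: (@measurableT_comp _ _ _ _ _ _ (fun a => cos (t * cos a)) _ _ (continuous_measurable_fun (@continuous_costcos t)) measurable_fst).
Qed.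

Lemma gauss_phase_majorant t a : 0 < t ->
  (\int[mu]_s (\1_D a * (sin a * expR (- (t * (1 - cos a) * s ^+ 2))))%:E =
   (\1_D a * (Num.sqrt (2 * pi / t) * cos (a / 2)))%:E)%E.
Proof.
move=> t0; rewrite indicE; have [aD|aD] := boolP (a \in D).
  under eq_integral do rewrite mul1r.
  by rewrite mul1r gauss_phase_inner//; move: aD; rewrite inE.
by under eq_integral do rewrite mul0r; rewrite integral0 mul0r.
Qed.

Lemma gauss_phase_le t a s :
  `|gauss_phase t (a, s)| <= \1_D a * (sin a * expR (- (t * (1 - cos a) * s ^+ 2))).
Proof.
rewrite /gauss_phase/= indicE; have [aD|aD] := boolP (a \in D); last by rewrite !mul0r normr0.
rewrite !mul1r normrM normrM (ger0_norm (expR_ge0 _)) ger0_norm ?ler_piMr ?cos_max ?mulr_ge0 ?expR_ge0//.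
  by move: aD; rewrite inE /D/= in_itv/= => /andP[a0 ap]; apply: sin_ge0_pi; rewrite ltW//= (le_trans ap)// ler_pdivrMr// ler_peMr ?pi_ge0// ler1n.
by move: aD; rewrite inE /D/= in_itv/= => /andP[a0 ap]; apply: sin_ge0_pi; rewrite ltW//= (le_trans ap)// ler_pdivrMr// ler_peMr ?pi_ge0// ler1n.
Qed.

Let mgauss_phase1 t a : measurable_fun setT (fun s => (gauss_phase t (a, s))%:E).
Proof.
apply/measurable_EFinP.
exact: (measurable_comp measurableT (@subsetT _ _) (@measurable_gauss_phase t) (pair1_measurable a)).
Qed.

Lemma gauss_phase_norm_le t a : 0 < t ->
  (\int[mu]_s `|(gauss_phase t (a, s))%:E| <= (\1_D a * (Num.sqrt (2 * pi / t) * cos (a / 2)))%:E)%E.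
Proof.
move=> t0; rewrite -gauss_phase_majorant//; apply: ge0_le_integral => //.
- by apply: measurableT_comp => //; exact: mgauss_phase1.
- apply/measurable_EFinP; apply: measurable_funM => //; apply: measurable_funM => //.
  by apply: measurableT_comp => //; apply: measurableT_comp => //; exact: measurable_funM.
- by move=> s _; rewrite lee_fin gauss_phase_le.
Qed.

Lemma gauss_phase_integrable1 t a : 0 < t -> mu.-integrable setT (fun s => (gauss_phase t (a, s))%:E).
Proof.
move=> t0; apply/integrableP; split; first exact: mgauss_phase1.
exact: le_lt_trans (gauss_phase_norm_le a t0) (ltry _).
Qed.

Lemma gauss_phase_integrable2 t s : 0 < t -> mu.-integrable setT (fun a => (gauss_phase t (a, s))%:E).
Proof.
move=> t0.
have iD : mu.-integrable setT (EFin \o (\1_D : R -> R)).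
  exact: integrable_indic_itv.
apply: le_integrable iD => //.
  apply/measurable_EFinP.
  exact: (measurable_comp measurableT (@subsetT _ _) (@measurable_gauss_phase t) (pair2_measurable s)).
move=> a _; rewrite /= lee_fin; apply: (le_trans (gauss_phase_le _ _ _)).
rewrite [leRHS]ger0_norm// ler_piMr//.
rewrite -[leRHS]mulr1; apply: le_trans (ler_norm _) _; rewrite normrM ler_pM ?sin_max//.
rewrite ger0_norm ?expR_ge0// -expR0 ler_expR oppr_le0 mulr_ge0 ?sqr_ge0// mulr_ge0 ?(ltW t0)// ?subr_ge0 ?cos_le1//.
Qed.

Lemma gauss_phase_integrable t : 0 < t -> (mu \x mu)%E.-integrable setT (EFin \o gauss_phase t).
Proof.
move=> t0; apply/integrable12ltyP; first by apply/measurable_EFinP; exact: measurable_gauss_phase.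
apply: (@le_lt_trans _ _ (\int[mu]_a (\1_D a * (Num.sqrt (2 * pi / t)))%:E)%E).
  apply: ge0_le_integral => //.
  - by move=> x _; exact: integral_ge0.
  - apply: (@measurable_fun_fubini_tonelli_F _ _ _ _ R mu (fun z => `|(gauss_phase t z)%:E|)%E) => //.
    by apply: measurableT_comp => //; apply/measurable_EFinP; exact: measurable_gauss_phase.
  - by apply/measurable_EFinP; apply: measurable_funM => //; apply: measurable_indic; exact: measurable_itv.
  - move=> a _; apply: le_trans (gauss_phase_norm_le a t0) _.
    by rewrite lee_fin ler_wpM2l// ler_piMr ?sqrtr_ge0// cos_le1.
under eq_integral do rewrite EFinM.
rewrite ge0_integralZr//; last first.
- by apply/measurable_EFinP; apply: measurable_indic; exact: measurable_itv.
rewrite integral_indic ?setIT//; last exact: measurable_itv.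
by rewrite /D/= lebesgue_measure_itv/= lte_fin D0/= -EFinM ltry.
Qed.

(** With u = cos a, this is the integral of an exponential times a cosine. *)
Lemma gauss_phase_outer (t s : R) : 0 < t ->
  \int[mu]_a gauss_phase t (a, s) =
  (s ^+ 2 * cos t + sin t - s ^+ 2 * expR (- (t * s ^+ 2))) / (t * (1 + s ^+ 4)).
Proof.
move=> t0.
pose F a : R := expR (- (t * (1 - cos a) * s ^+ 2)) * (- s ^+ 2 * cos (t * cos a) - sin (t * cos a)) / (t * (1 + s ^+ 4)).
have dF (a : R) : is_derive a 1 F (sin a * expR (- (t * (1 - cos a) * s ^+ 2)) * cos (t * cos a)).
  rewrite /F; apply: is_derive_eq; rewrite /GRing.scale/=; field.
  by rewrite (gt_eqF t0) (gt_eqF (oneDX4_gt0 s)).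
have cf : continuous (fun a : R => sin a * expR (- (t * (1 - cos a) * s ^+ 2)) * cos (t * cos a)).
  by move=> a; apply: is_derive1_continuous.
transitivity (\int[mu]_(a in `[0, pi / 2]) (sin a * expR (- (t * (1 - cos a) * s ^+ 2)) * cos (t * cos a))).
  rewrite -Rintegral_itv_obnd_cbnd; last exact: integrable_continuous_oc.
  rewrite [RHS]Rintegral_mkcond; apply: eq_Rintegral => a _.
  by rewrite /gauss_phase patchE indicE /=; case: ifPn => _; rewrite ?mul1r ?mul0r.
rewrite (Rintegral_FTC D0 (fun a _ => dF a)); last exact: continuous_subspaceT.
rewrite /F cos_pihalf cos0 subr0 !mulr0 cos0 sin0 subrr mulr1 mulr0 mul0r oppr0 expR0; field.
by rewrite (gt_eqF t0) (gt_eqF (oneDX4_gt0 s)).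
Qed.

Let A0 : R := pi / Num.sqrt 2.

Lemma integrable_oneDX4V : mu.-integrable setT (EFin \o (fun s : R => (1 + s ^+ 4)^-1)).
Proof.
apply/integrableP; split; first by apply/measurable_EFinP; apply: continuous_measurable_fun; exact: continuous_oneDX4V.
rewrite (_ : \int[mu]_x _ = A0%:E)%E ?ltry// -integral_oneDX4V; apply: eq_integral => x _ /=.
by rewrite ger0_norm// invr_ge0 ltW// oneDX4_gt0.
Qed.

Lemma measurable_X2oneDX4V : measurable_fun setT (fun s : R => s ^+ 2 / (1 + s ^+ 4)).
Proof. by apply: measurable_funM => //; apply: continuous_measurable_fun; exact: continuous_oneDX4V. Qed.

Lemma integrable_X2oneDX4V : mu.-integrable setT (EFin \o (fun s : R => s ^+ 2 / (1 + s ^+ 4))).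
Proof.
apply/integrableP; split; first by apply/measurable_EFinP; exact: measurable_X2oneDX4V.
rewrite (_ : \int[mu]_x _ = A0%:E)%E ?ltry// -integral_X2oneDX4V; apply: eq_integral => x _ /=.
by rewrite ger0_norm// mulr_ge0 ?sqr_ge0// invr_ge0 ltW// oneDX4_gt0.
Qed.

(** The contribution of the endpoint [a = pi/2] is small since
    t s^2 e^(-t s^2) <= 1. *)
Lemma gauss_tail (t : R) : 0 < t ->
  let g := fun s : R => s ^+ 2 * expR (- (t * s ^+ 2)) / (1 + s ^+ 4) in
  mu.-integrable setT (EFin \o g) /\ `|\int[mu]_s g s| <= A0 / t.
Proof.
move=> t0 g.
have mg : measurable_fun setT g.
  apply: measurable_funM; last by apply: continuous_measurable_fun; exact: continuous_oneDX4V.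
  by apply: measurable_funM => //; apply: measurableT_comp => //; apply: measurableT_comp => //; exact: measurable_funM.
have g0 s : 0 <= g s.
  by apply: divr_ge0; [apply: mulr_ge0; [exact: sqr_ge0|exact: expR_ge0]|exact/ltW/oneDX4_gt0].
have gle s : g s <= t^-1 * (1 + s ^+ 4)^-1.
  rewrite ler_pM2r ?invr_gt0 ?oneDX4_gt0// expRN ler_pdivrMr ?expR_gt0// ler_pdivlMl//.
  by have := expR_ge1Dx (t * s ^+ 2); lra.
have ig1 := integrableZl measurableT t^-1 integrable_oneDX4V.
have ig : mu.-integrable setT (EFin \o g).
  apply: le_integrable ig1 => //; first exact/measurable_EFinP.
  move=> s _ /=; rewrite lee_fin ger0_norm// (le_trans (gle s))//.
  exact: ler_norm.
split => //; rewrite ger0_norm; last by apply: Rintegral_ge0.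
(* A0 / t is the integral of the majorant (1 + s^4)^-1 / t. *)
rewrite (_ : A0 / t = \int[mu]_s (t^-1 * (1 + s ^+ 4)^-1)); last first.
  by rewrite RintegralZl ?integrable_oneDX4V// /Rintegral integral_oneDX4V/= mulrC.
exact: le_Rintegral.
Qed.

(** Fubini for [gauss_phase]: the integral in [s] first gives the half-angle
    weight, the integral in [a] first gives the explicit leading term. *)
Lemma half_angle_main (t : R) : 0 < t ->
  `|Num.sqrt (2 * pi / t) * \int[mu]_(a in `[0, pi / 2]) (cos (t * cos a) * cos (a / 2)) -
    t^-1 * (A0 * (cos t + sin t))| <= A0 / t ^+ 2.
Proof.
move=> t0; have [ig gle] := gauss_tail t0.
have := Rintegral_fubini12 (gauss_phase_integrable t0) (fun a => gauss_phase_integrable1 a t0).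
rewrite -(Rintegral_fubini21 (gauss_phase_integrable t0) (fun a => gauss_phase_integrable2 a t0)).
have -> : \int[mu]_a \int[mu]_s gauss_phase t (a, s) =
   Num.sqrt (2 * pi / t) * \int[mu]_(a in `[0, pi / 2]) (cos (t * cos a) * cos (a / 2)).
  have cf : continuous (fun a : R => cos (t * cos a) * cos (a / 2)) by move=> a; apply: is_derive1_continuous.
  rewrite -RintegralZl//; last by apply: integrable_continuous; exact: continuous_subspaceT.
  rewrite -Rintegral_itv_obnd_cbnd; last first.
    by apply: integrable_continuous_oc => a; apply: cvgM; [exact: cvg_cst|exact: cf].
  rewrite [RHS]Rintegral_mkcond; apply: eq_Rintegral => a _.
  rewrite patchE; under eq_Rintegral do rewrite /gauss_phase indicE /=.
  case: ifPn => aD; last first.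
    under eq_Rintegral do rewrite mul0r; by rewrite /Rintegral integral0.
  rewrite /Rintegral; under eq_integral do rewrite mul1r mulrC EFinM.
  rewrite integralZl//; last first.
    apply/integrableP; split.
      apply/measurable_EFinP; apply: measurable_funM => //.
      by apply: measurableT_comp => //; apply: measurableT_comp => //; exact: measurable_funM.
    rewrite (_ : \int[mu]_x _ = (Num.sqrt (2 * pi / t) * cos (a / 2))%:E)%E ?ltry//.
    rewrite -gauss_phase_inner//; last by move: aD; rewrite inE.
    apply: eq_integral => s _; rewrite /= ger0_norm// mulr_ge0 ?expR_ge0//.
    by move: aD; rewrite inE /D/= in_itv/= => /andP[a0 ap]; apply: sin_ge0_pi; rewrite ltW//= (le_trans ap)// ler_pdivrMr// ler_peMr ?pi_ge0// ler1n.
  rewrite gauss_phase_inner//; last by move: aD; rewrite inE.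
  by rewrite -EFinM/= mulrCA.
move=> ->.
under eq_Rintegral do rewrite (gauss_phase_outer _ t0).
rewrite (_ : \int[mu]_x _ = \int[mu]_s ((t^-1 * cos t * (s ^+ 2 / (1 + s ^+ 4)) + t^-1 * sin t * (1 + s ^+ 4)^-1)
    - t^-1 * (s ^+ 2 * expR (- (t * s ^+ 2)) / (1 + s ^+ 4)))); last first.
  by apply: eq_Rintegral => s _; field; rewrite (gt_eqF t0) (gt_eqF (oneDX4_gt0 s)).
have i1 := integrableZl measurableT (t^-1 * cos t) integrable_X2oneDX4V.
have i2 := integrableZl measurableT (t^-1 * sin t) integrable_oneDX4V.
have i3 := integrableZl measurableT t^-1 ig.
rewrite RintegralB//; last exact: (integrableD measurableT i1 i2).
rewrite RintegralD// RintegralZl ?integrable_X2oneDX4V// RintegralZl ?integrable_oneDX4V// RintegralZl//.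
rewrite {1 2}/Rintegral integral_oneDX4V integral_X2oneDX4V/= -/A0.
set I := \int[mu]_s _ in gle *.
rewrite (_ : _ - _ = - (t^-1 * I)); last by ring.
rewrite normrN normrM ger0_norm ?invr_ge0 ?(ltW t0)//.
rewrite (_ : A0 / t ^+ 2 = t^-1 * (A0 / t)); last by field; exact: lt0r_neq0.
by rewrite ler_pM2l ?invr_gt0.
Qed.

Lemma cos_piquarter : cos (pi / 4) = (Num.sqrt 2)^-1 :> R.
Proof.
have c0 : 0 < cos (pi / 4) :> R.
  apply: cos_gt0_pihalf; have := pi_gt0 R; move=> ?; apply/andP; split; lra.
have e : cos (pi / 4) ^+ 2 = 2^-1 :> R.
  have := cos_mulr2n (pi / 4 : R); rewrite (_ : pi / 4 *+ 2 = pi / 2) ?cos_pihalf; last by field.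
  rewrite -mulr_natl; lra.
by rewrite -sqrtrV// -e sqrtr_sqr gtr0_norm.
Qed.

Lemma sin_piquarter : sin (pi / 4) = (Num.sqrt 2)^-1 :> R.
Proof.
have s0 : 0 < sin (pi / 4) :> R.
  apply: sin_gt0_pihalf; have := pi_gt0 R; move=> ?; apply/andP; split; lra.
have e : sin (pi / 4) ^+ 2 = 2^-1 :> R.
  rewrite sin2cos2 cos_piquarter exprVn sqr_sqrtr//; lra.
by rewrite -sqrtrV// -e sqrtr_sqr gtr0_norm.
Qed.

(** Since 1/sqrt 2 is both the sine and the cosine of [pi/4], the sum cos t + sin t
    of the leading term is a shifted cosine. *)
Lemma bessel_asymptotics : exists C : R, forall t : R, 1 <= t ->
  `|bessel t - Num.sqrt (2 / (pi * t)) * cos (t - pi / 4)| <= C / t.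
Proof.
exists (2 / pi * (5 * (pi / 2) + A0)) => t t1.
have t0 : 0 < t by apply: lt_le_trans t1.
have pi0 : (0 : R) < pi := pi_gt0 R.
have h1 := half_angle_main t0; have h2 := half_angle_remainder t0.
have A00 : 0 <= A0 by rewrite divr_ge0 ?pi_ge0// sqrtr_ge0.
set I1 := \int[mu]_(a in _) _ in h1; set I2 := \int[mu]_(a in _) _ in h2.
set K := Num.sqrt (2 * pi / t) in h1.
have K0 : 0 < K by rewrite sqrtr_gt0 divr_gt0// mulr_gt0.
have K2 : K ^+ 2 = 2 * pi / t by rewrite sqr_sqrtr// ltW// divr_gt0// mulr_gt0.
have EJ : bessel t = 2 / pi * (I1 + I2).
  rewrite /bessel -RintegralD//; last 2 first.
  - apply: integrable_continuous; apply: continuous_subspaceT => a; by apply: is_derive1_continuous.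
  - apply: integrable_continuous; apply: continuous_subspaceT => a; by apply: is_derive1_continuous.
  by congr (_ * _); apply: eq_Rintegral => a _; ring.
have EM : Num.sqrt (2 / (pi * t)) * cos (t - pi / 4) = 2 / pi * (K^-1 * (t^-1 * (A0 * (cos t + sin t)))).
  have -> : Num.sqrt (2 / (pi * t)) = 2 / (t * K).
    apply: (mulIf (lt0r_neq0 K0)); rewrite -sqrtrM ?divr_ge0 ?mulr_ge0 ?ltW//.
    rewrite (_ : 2 / (pi * t) * (2 * pi / t) = (2 / t) ^+ 2); last first.
      have aux (p : R) : 0 < p -> 2 / (p * t) * (2 * p / t) = (2 / t) ^+ 2 by move=> p0; field; rewrite !gt_eqF//.
      exact: aux.
    by rewrite sqrtr_sqr ger0_norm ?divr_ge0 ?ltW//; field; rewrite !gt_eqF//.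
  have q0 : 0 < Num.sqrt 2 :> R by rewrite sqrtr_gt0.
  have aux (p q c s : R) : 0 < p -> 0 < q -> 2 / (t * K) * (c * q^-1 + s * q^-1) = 2 / p * (K^-1 * (t^-1 * (p / q * (c + s)))).
    by move=> p0 q0'; field; rewrite !gt_eqF.
  by rewrite cosB cos_piquarter sin_piquarter (aux pi).
(* K^-1 is of order sqrt t, hence K^-1 (A0 / t^2) is at most A0 / t. *)
have Kt : K^-1 / t <= 1.
  have Kt0 : 0 < K * t by rewrite mulr_gt0.
  rewrite -invfM invf_le1// -ler_sqr ?nnegrE ?(ltW Kt0)//.
  have -> : (K * t) ^+ 2 = t * (2 * pi).
    rewrite exprMn K2; have aux (p : R) : 2 * p / t * t ^+ 2 = t * (2 * p) by field; exact: lt0r_neq0.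
    exact: aux.
  by have := pi_ge2 R; nra.
rewrite EJ EM -mulrBr normrM ger0_norm ?divr_ge0 ?(ltW pi0)// -[leRHS]mulrA ler_pM2l ?divr_gt0//.
rewrite addrAC; apply: (le_trans (ler_normD _ _)).
rewrite (mulrDl _ _ t^-1) [leRHS]addrC; apply: lerD => //.
have -> : I1 - K^-1 * (t^-1 * (A0 * (cos t + sin t))) = K^-1 * (K * I1 - t^-1 * (A0 * (cos t + sin t))).
  by rewrite [RHS]mulrBr mulKf// lt0r_neq0.
rewrite normrM (@ger0_norm _ K^-1) ?invr_ge0 ?(ltW K0)//.
apply: (@le_trans _ _ (K^-1 * (A0 / t ^+ 2))); first by rewrite ler_pM2l ?invr_gt0.
have -> : K^-1 * (A0 / t ^+ 2) = (K^-1 / t) * (A0 / t) by rewrite expr2 invfM; ring.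
by rewrite ler_piMl// divr_ge0// ltW.
Qed.
End bessel.

(** * Averaging over rotations *)

Section average.
Context {R : realType}.
Local Notation mu := (@lebesgue_measure R).
Local Notation mu2 := (@leb2 R).

Lemma polar_angle (c s : R) : c ^+ 2 + s ^+ 2 = 1 ->
  exists2 a : R, - pi <= a <= pi & c = cos a /\ s = sin a.
Proof.
move=> cs.
have c1 : -1 <= c <= 1.
  by rewrite -ler_norml -ler_sqr ?nnegrE// expr1n real_normK ?num_real// -cs lerDl sqr_ge0.
have a0 := acos_ge0 c1; have ap := acos_lepi c1.
have cK : cos (acos c) = c by apply: acosK; rewrite in_itv.
have sK : sin (acos c) ^+ 2 = s ^+ 2 by rewrite sin2cos2 cK -cs; ring.
have sa0 : 0 <= sin (acos c) by apply: sin_ge0_pi; rewrite a0.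
have := pi_ge0 R => p0.
have [s0|s0] := leP 0 s.
  exists (acos c); first by apply/andP; split; lra.
  split=> //; apply/eqP; rewrite -(eqrXn2 (n := 2))// sK//.
exists (- acos c); first by apply/andP; split; lra.
rewrite cosN sinN; split => //; apply/eqP; by rewrite -eqr_oppLR -(eqrXn2 (n := 2)) ?sqrrN ?sK// oppr_ge0 (ltW s0).
Qed.

Variable t : R.
Let P (a : R) : R := cos (t * cos a).
Let Q (x : R) : R := \int[mu]_(a in `[- 5, x]) P a.

Let cP : continuous P. Proof. exact: continuous_costcos. Qed.

Let dQ (x : R) : -5 < x -> is_derive x 1 Q (P x).
Proof.
move=> x5.
have xu : x < x + 1 by rewrite ltrDl.
have [| | |d e] := @continuous_FTC1 R P (BLeft (- 5)) x (x + 1) xu.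
- by apply: integrable_continuous; exact: continuous_subspaceT.
- by rewrite lte_fin.
- exact: cP.
by apply: DeriveDef; [exact: d|rewrite -derive1E; exact: e].
Qed.

Let derive0_cst (K : R -> R) (a b : R) : a <= b ->
  (forall x, a <= x <= b -> is_derive x 1 K 0) -> K a = K b.
Proof.
rewrite le_eqVlt => /predU1P[->//|ab] dK.
apply/eqP; rewrite eq_sym -subr_eq0 -(Rintegral_FTC ab dK).
  by rewrite /Rintegral integral0.
by apply: continuous_subspaceT => ?; exact: cvg_cst.
Qed.

Let pi4 : pi < 4 :> R.
Proof. by have := @pihalf_lt2 R; rewrite ltr_pdivrMr// -natrM. Qed.

Let PDpi a : P (a + pi) = P a.
Proof. by rewrite /P cosDpi mulrN cosN. Qed.

Let shift_const (a : R) : - pi <= a <= pi -> Q (a + pi) - Q a = Q pi - Q 0.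
Proof.
move=> /andP[ap pa]; have p4 := pi4.
have d (x : R) : -5 < x -> is_derive x 1 (fun x => Q (x + pi) - Q x) 0.
  move=> x5; have := dQ x5.
  have x6 : -5 < x + pi by rewrite ltr_wpDr ?pi_ge0.
  move=> d1; have d2 := dQ x6.
  by apply: is_derive_eq; rewrite /GRing.scale/= PDpi; ring.
have [a0|a0] := leP 0 a.
  rewrite -[Q pi]/(Q pi) -{2}[pi]add0r; apply/esym.
  by apply: (derive0_cst (K := fun x => Q (x + pi) - Q x)) => // x /andP[x0 _]; apply: d; lra.
rewrite -{2}[pi]add0r.
by apply: (derive0_cst (K := fun x => Q (x + pi) - Q x)) => [|x /andP[x0 _]]; [exact: ltW|apply: d; lra].
Qed.

Let half_pi : Q pi - Q 0 = pi * bessel t.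
Proof.
have p0 := pi_gt0 R.
have d (x : R) : 0 <= x <= pi / 2 -> is_derive x 1 (fun x => Q x + Q (pi - x)) 0.
  move=> /andP[x0 x1]; have x5 : -5 < x by lra.
  have x6 : -5 < pi - x by lra.
  have d1 := dQ x5; have d2 := dQ x6.
  apply: is_derive_eq; rewrite /GRing.scale/=.
  have -> : P (pi - x) = P x by rewrite /P cosB cospi sinpi mul0r addr0 mulN1r mulrN cosN.
  ring.
have h0 : 0 <= pi / 2 :> R by rewrite divr_ge0// ltW.
have E := derive0_cst h0 d.
have h1 : 0 < pi / 2 :> R by rewrite divr_gt0.
have e : \int[mu]_(a in `[0, pi / 2]) P a = Q (pi / 2) - Q 0.
  apply: Rintegral_FTC => //; last exact: continuous_subspaceT.
  by move=> x /andP[x0 _]; apply: dQ; lra.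
rewrite /bessel e.
have e2 : pi - pi / 2 = pi / 2 :> R by lra.
move: E; rewrite e2 subr0 => E.
rewrite mulrA mulrCA mulfV ?mulr1 ?gt_eqF//; lra.
Qed.

(** By the period [pi] of a -> cos(t cos a) the mean over any half-turn is the
    same, and by symmetry about [pi/2] it is the mean over a quarter-turn. The
    derivative of a primitive expresses both without a change of variables. *)
Lemma bessel_average (a : R) : - pi <= a <= pi ->
  \int[mu]_(x in `[0, pi]) cos (t * cos (x + a)) = pi * bessel t.
Proof.
move=> h; rewrite -half_pi -(shift_const h) -{3}[a]add0r [a + pi]addrC.
move: h => /andP[h1 h2]; have p4 := pi4.
apply: (Rintegral_FTC (F := fun x => Q (x + a))) => //; first exact: pi_gt0.
  move=> x /andP[x0 _]; have x5 : -5 < x + a by lra.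
  have d := dQ x5.
  by apply: is_derive_eq; rewrite /GRing.scale/= addr0 mulr1.
by apply: continuous_subspaceT => x; apply: is_derive1_continuous.
Qed.

Lemma measurable_sqrtr : measurable_fun setT (@Num.sqrt R).
Proof. by apply: continuous_measurable_fun; exact: sqrt_continuous. Qed.

Lemma measurable_enorm : measurable_fun setT (@enorm R).
Proof.
apply: measurableT_comp; first exact: measurable_sqrtr.
by apply: measurable_funD; apply: measurable_funM.
Qed.

Lemma enorm_ge0 (x : R * R) : 0 <= enorm x. Proof. exact: sqrtr_ge0. Qed.

Lemma enorm_sqr (x : R * R) : enorm x ^+ 2 = x.1 ^+ 2 + x.2 ^+ 2.
Proof. by rewrite /enorm sqr_sqrtr /dot2 -?expr2// addr_ge0 ?sqr_ge0. Qed.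

Lemma enorm_eq0 (x : R * R) : (enorm x == 0) = (x == (0, 0)).
Proof.
case: x => a b; rewrite -sqrf_eq0 enorm_sqr/= paddr_eq0 ?sqr_ge0// !sqrf_eq0.
by apply/andP/eqP => [[/eqP-> /eqP->//]|[-> ->]].
Qed.

(** The inverse is a power, which is known to be measurable. *)
Lemma measurable_enormV : measurable_fun setT (fun x : R * R => (enorm x)^-1).
Proof.
rewrite (_ : (fun _ => _) = (fun x : R => x `^ (-1)) \o @enorm R); last first.
  by apply/funext => x /=; rewrite powR_inv1// enorm_ge0.
apply: measurableT_comp; [exact: measurable_powR|exact: measurable_enorm].
Qed.

Lemma enorm_rotation (c s : R) (x : R * R) : c ^+ 2 + s ^+ 2 = 1 -> enorm (rotation c s x) = enorm x.
Proof.
move=> cs; apply/eqP; rewrite -(eqrXn2 (n := 2)) ?enorm_ge0// !enorm_sqr /rotation/=.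
apply/eqP; transitivity ((c ^+ 2 + s ^+ 2) * (x.1 ^+ 2 + x.2 ^+ 2)); first by ring.
by rewrite cs mul1r.
Qed.

Lemma leb2_origin : mu2 [set (0, 0)] = 0%E.
Proof.
have -> : [set (0, 0)] = [set (0 : R)] `*` [set (0 : R)].
  by apply/seteqP; split => [[a b] [-> ->]|[a b] [/= -> ->]].
by rewrite [LHS](product_measure1E (lebesgue_measure : {measure set (measurableTypeR R) -> \bar R}))//= ?lebesgue_measure_set1 ?mule0//; exact: measurable_set1.
Qed.

Lemma measurable_origin : measurable [set ((0, 0) : R * R)].
Proof.
have -> : [set (0, 0)] = [set (0 : R)] `*` [set (0 : R)].
  by apply/seteqP; split => [[a b] [-> ->]|[a b] [/= -> ->]].
by apply: measurableX; exact: measurable_set1.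
Qed.

Definition rot_invariant (F : R * R -> R) := forall c s x, c ^+ 2 + s ^+ 2 = 1 -> F (rotation c s x) = F x.

Lemma unit_direction (x : R * R) : x != (0, 0) -> (x.1 / enorm x) ^+ 2 + (x.2 / enorm x) ^+ 2 = 1.
Proof.
move=> x0; rewrite !exprMn -mulrDl -enorm_sqr -exprMn mulfV ?expr1n//.
by rewrite enorm_eq0.
Qed.

Lemma integrable_measurable (F : R * R -> R) : mu2.-integrable setT (EFin \o F) -> measurable_fun setT F.
Proof. by move=> iF; apply/measurable_EFinP; exact: measurable_int iF. Qed.

Lemma integrable_mul_le M (F c : R * R -> R) : mu2.-integrable setT (EFin \o F) ->
  measurable_fun setT c -> (forall z, `|c z| <= M) ->
  mu2.-integrable setT (EFin \o (fun x => F x * c x)).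
Proof.
move=> iF mc cM; have mF := integrable_measurable iF.
have := integrableZl measurableT M (integrable_norm iF); apply: le_integrable => //.
  by apply/measurable_EFinP; exact: measurable_funM.
move=> x _; rewrite /= lee_fin normrM mulrC.
apply: le_trans (ler_norm _); exact: ler_wpM2r.
Qed.

Lemma integrable_mul_bounded (F c : R * R -> R) : mu2.-integrable setT (EFin \o F) ->
  measurable_fun setT c -> (forall z, `|c z| <= 1) ->
  mu2.-integrable setT (EFin \o (fun x => F x * c x)).
Proof. exact: integrable_mul_le. Qed.

(** Integrate over all rotations by an angle in [0, pi] and exchange the
    integrals: for fixed angle the integral does not depend on the angle, for
    fixed [x] the mean over the angles is [bessel_average]. *)
Lemma rotation_average (F : R * R -> R) : mu2.-integrable setT (EFin \o F) -> rot_invariant F ->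
  \int[mu2]_x (F x * cos (t * (x.1 / enorm x))) = bessel t * \int[mu2]_x F x.
Proof.
move=> iF rF.
have mF := integrable_measurable iF.
pose D : set R := `[0, pi]%classic.
pose C (z : R * (R * R)) : R := cos (t * ((rotation (cos z.1) (sin z.1) z.2).1 / enorm z.2)).
have mcos : measurable_fun setT (@cos R) by apply: continuous_measurable_fun; exact: continuous_cos.
have msin : measurable_fun setT (@sin R) by apply: continuous_measurable_fun; exact: continuous_sin.
have mC : measurable_fun setT C.
  apply: measurableT_comp => //; apply: measurable_funM => //; apply: measurable_funM; last first.
    by apply: (measurableT_comp measurable_enormV); exact: measurable_snd.
  rewrite /rotation/=; apply: measurable_funB; apply: measurable_funM.
  - by apply: (measurableT_comp mcos); exact: measurable_fst.
  - by apply: (measurableT_comp measurable_fst); exact: measurable_snd.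
  - by apply: (measurableT_comp msin); exact: measurable_fst.
  - by apply: (measurableT_comp measurable_snd); exact: measurable_snd.
have m1D : measurable_fun setT (\1_D : R -> R) by apply: measurable_indic; exact: measurable_itv.
have mD : mu.-integrable setT (EFin \o (\1_D : R -> R)) by exact: integrable_indic_itv.
have C1 z : `|C z| <= 1 by exact: cos_max.
have iG := integrable_prodM mD iF mC C1.
have mCa a : measurable_fun setT (fun x => C (a, x)).
  exact: (measurable_comp measurableT (@subsetT _ _) mC (pair1_measurable a)).
have mCx x : measurable_fun setT (fun a => C (a, x)).
  exact: (measurable_comp measurableT (@subsetT _ _) mC (pair2_measurable x)).
have i1 a : mu2.-integrable setT (fun x => (\1_D a * F x * C (a, x))%:E).
  have := integrableZl measurableT (\1_D a) (integrable_mul_bounded iF (mCa a) (fun x => C1 (a, x))).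
  by apply: eq_integrable => // x _ /=; rewrite -mulrA EFinM.
have i2 x : mu.-integrable setT (fun a => (\1_D a * F x * C (a, x))%:E).
  apply: le_integrable (integrableZl measurableT (F x) mD) => //.
    by apply/measurable_EFinP; apply: measurable_funM; [exact: measurable_funM|exact: mCx].
  by move=> a _; rewrite /= lee_fin normrM (mulrC (F x)) ler_piMr.
(* The integral over the plane first: it does not depend on the angle. *)
have pi0 := pi_gt0 R.
have E1 : \int[mu]_a \int[mu2]_x (\1_D a * F x * C (a, x)) =
    pi * \int[mu2]_x (F x * cos (t * (x.1 / enorm x))).
  set I := \int[mu2]_x (_ * _).
  have -> : \int[mu]_a \int[mu2]_x (\1_D a * F x * C (a, x)) = \int[mu]_a (\1_D a * I).
    apply: eq_Rintegral => a _.
    under eq_Rintegral do rewrite -mulrA.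
    rewrite RintegralZl//; last exact: integrable_mul_bounded.
    congr (_ * _).
    have cs := cos2Dsin2 a.
    rewrite /I -(@scales_area_Rintegral _ _ _ (fun x => F x * cos (t * (x.1 / enorm x))) ltr01 (scales_area_rotation cs)).
      by rewrite mul1r; apply: eq_Rintegral => x _; rewrite rF// enorm_rotation.
    apply: measurable_funM => //; apply: measurableT_comp => //; apply: measurable_funM => //.
    by apply: measurable_funM => //; exact: measurable_enormV.
  rewrite RintegralZr//; congr (_ * _).
  rewrite /Rintegral integral_indic ?setIT//=; last exact: measurable_itv.
  by rewrite /D/= lebesgue_measure_itv/= lte_fin pi0/= subr0.
(* The integral over the angle first: away from the origin, a rotation shifts
   the polar angle. *)
have E2 : \int[mu2]_x \int[mu]_a (\1_D a * F x * C (a, x)) = pi * bessel t * \int[mu2]_x F x.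
  rewrite -RintegralZl//.
  apply: (@eq_Rintegral_off_null _ _ R mu2 [set (0, 0)]).
  - exact: measurable_origin.
  - exact: leb2_origin.
  - exact: (measurable_Rint1 iG i2).
  - exact: measurable_funM.
  move=> x x0; have {}x0 : x != (0, 0) by apply/eqP.
  (* b is the polar angle of x. *)
  have [b bpi [hc hs]] := polar_angle (unit_direction x0).
  rewrite -(bessel_average bpi) -RintegralZr//; last first.
    by apply: integrable_continuous; apply: continuous_subspaceT => a; apply: is_derive1_continuous.
  rewrite [RHS]Rintegral_mkcond; apply: eq_Rintegral => a _.
  rewrite patchE indicE /C/=; case: ifPn => _; last by rewrite !mul0r.
  rewrite mul1r mulrC cosD; congr (cos (t * _) * _).
  by rewrite -hc -hs mulrBl !mulrA.
have := Rintegral_fubini12 iG i1; rewrite -(Rintegral_fubini21 iG i2) E1 E2 -mulrA.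
by move/mulfI; apply; rewrite gt_eqF.
Qed.

End average.

(** * Smooth bumps and the decay of their transform *)

Section beta.
Context {R : realType}.

(** The functions s^(-n) e^(-1/s), extended by 0 to s <= 0. Unlike the single
    function e^(-1/s), this family is closed under differentiation up to linear
    combinations, so that smoothness follows by induction. *)
Definition beta (n : nat) (s : R) : R := if 0 < s then s^-1 ^+ n * expR (- s^-1) else 0.

(** Bounds [beta], with x = 1/s. *)
Lemma powX_le_expR n (x : R) : 0 <= x -> x ^+ n <= n`!%:R * expR x.
Proof.
move=> x0; case: n => [|n]; first by rewrite expr0 mul1r -expR0 ler_expR.
have n0 : 0 < n.+1`!%:R :> R by rewrite ltr0n fact_gt0.
rewrite -ler_pdivrMl// mulrC; apply: le_trans (expR_ge1Dxn n x0).
by rewrite lerDr.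
Qed.

Lemma beta_ge0 n s : 0 <= beta n s.
Proof. by rewrite /beta; case: ifPn => // s0; rewrite mulr_ge0 ?expR_ge0// exprn_ge0// invr_ge0 ltW. Qed.

Lemma beta_le n s : beta n s <= n`!%:R.
Proof.
rewrite /beta; case: ifPn => // s0; rewrite expRN ler_pdivrMr ?expR_gt0//.
by apply: powX_le_expR; rewrite invr_ge0 ltW.
Qed.

Lemma betaE n s : beta n s = s * (s * beta n.+2 s).
Proof.
rewrite /beta; case: ifPn => s0; last by rewrite !mulr0.
by rewrite !exprS; field; exact: lt0r_neq0.
Qed.

Global Instance derive_beta n (s : R) : is_derive s 1 (beta n) (beta n.+2 s - n%:R * beta n.+1 s).
Proof.
have [s0|s0|->] := ltgtP s 0.
- have -> : beta n.+2 s - n%:R * beta n.+1 s = 0 by rewrite /beta ltNge (ltW s0) /= mulr0 subr0.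
  apply: (@near_eq_is_derive _ _ _ (cst 0)) => //; near=> x.
  rewrite /beta ltNge ltW//=; near: x; exact: lt_nbhsl.
- have sn : s != 0 by rewrite gt_eqF.
  apply: (@near_eq_is_derive _ _ _ (fun s : R => s^-1 ^+ n * expR (- s^-1))) => //.
    near=> x; rewrite /beta ifT//; near: x; exact: lt_nbhsr.
  have dV : is_derive s 1 (fun x : R => x^-1) (- s ^- 2).
    by have := is_deriveV sn (is_derive_id s 1); rewrite /GRing.scale/= mulr1.
  have -> : beta n.+2 s - n%:R * beta n.+1 s =
      s^-1 ^+ n * (s ^- 2 * expR (- s^-1)) + expR (- s^-1) * (n%:R * (s^-1 ^+ n.-1 * - s ^- 2)).
    rewrite /beta s0 -exprVn; case: n => [|n]; rewrite ?mul0r ?mulr0 ?exprS/=; ring.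
  have d1 : is_derive s 1 (fun x : R => x^-1 ^+ n) (n%:R * s^-1 ^+ n.-1 * - s ^- 2) .
    have dX : is_derive s^-1 1 (fun y : R => y ^+ n) (n%:R * s^-1 ^+ n.-1).
      by apply: DeriveDef; [exact: exprn_derivable|rewrite exp_derive /GRing.scale/= mulr1].
    exact: (@is_derive1_comp R (fun y : R => y ^+ n) (fun x : R => x^-1) s _ _ dX dV).
  have d2 : is_derive s 1 (fun x : R => - x^-1) (s ^- 2) by rewrite -[s ^- 2]opprK; exact: is_deriveN.
  have d3 : is_derive s 1 (fun x : R => expR (- x^-1)) (expR (- s^-1) * s ^- 2).
    exact: (@is_derive1_comp R expR (fun x : R => - x^-1) s _ _ (is_derive_expR _) d2).
  have d4 := is_deriveM d1 d3.
  by apply: (is_derive_eq d4); rewrite /GRing.scale/=; ring.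
have -> : beta n.+2 0 - n%:R * beta n.+1 0 = 0 by rewrite /beta ltxx mulr0 subr0.
(* At 0 the slope of beta n is s (beta n.+2 s), by betaE, and tends to 0. *)
apply/is_derive1_caratheodory; exists (fun z => z * beta n.+2 z); split.
- by move=> z; rewrite betaE {2}/beta ltxx !subr0 mulrC.
- rewrite /prop_for /continuous_at mul0r; apply/cvgr0Pnorm_le => e e0; near=> x.
  rewrite normrM (ger0_norm (beta_ge0 _ _)).
  have k0 : 0 < n.+2`!%:R :> R by rewrite ltr0n fact_gt0.
  apply: (@le_trans _ _ (`|x| * n.+2`!%:R)); first by rewrite ler_wpM2l// beta_le.
  rewrite -ler_pdivlMr//; near: x.
  exists (e / n.+2`!%:R); first by rewrite /= divr_gt0.
  by move=> y /=; rewrite sub0r normrN => /ltW.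
- by rewrite mul0r.
Unshelve. all: by end_near. Qed.

Lemma continuous_beta n : continuous (beta n).
Proof. by move=> s; apply: is_derive1_continuous. Qed.

(** Partial derivatives are one-dimensional derivatives along lines. *)
Lemma derive_line (F : R * R -> R) (x v : R * R) (d : R) :
  is_derive (0 : R) 1 (fun h : R => F (h *: v + x)) d -> is_derive x v F d.
Proof.
move=> [h1 h2]; split; first exact/derivable1P.
rewrite -h2 /derive; set g1 := fun h => h^-1 *: _; set g2 := fun h => h^-1 *: _.
suff -> : g1 = g2 by [].
by rewrite funeqE /g1 /g2 => h /=; rewrite addr0 scale0r add0r [_%:A]mulr1.
Qed.

(** A class of functions supported in the disc of radius [e] and closed under
    both partial derivatives; membership therefore implies smoothness, and
    repeated integrations by parts stay within the class. *)
Inductive bumpy (e : R) : (R * R -> R) -> Prop :=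
| bumpy_beta n : bumpy e (fun x => beta n (e ^+ 2 - (x.1 ^+ 2 + x.2 ^+ 2)))
| bumpy_X1 F : bumpy e F -> bumpy e (fun x => x.1 * F x)
| bumpy_X2 F : bumpy e F -> bumpy e (fun x => x.2 * F x)
| bumpy_scale c F : bumpy e F -> bumpy e (fun x => c * F x)
| bumpy_add F G : bumpy e F -> bumpy e G -> bumpy e (fun x => F x + G x).

Lemma derive_fst1 (x : R * R) : is_derive x (1, 0) (fun x : R * R => x.1) (1 : R).
Proof. by apply: derive_line => /=; apply: is_derive_eq; rewrite /GRing.scale/=; ring. Qed.
Lemma derive_fst2 (x : R * R) : is_derive x (0, 1) (fun x : R * R => x.1) (0 : R).
Proof. by apply: derive_line => /=; apply: is_derive_eq; rewrite /GRing.scale/=; ring. Qed.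
Lemma derive_snd1 (x : R * R) : is_derive x (1, 0) (fun x : R * R => x.2) (0 : R).
Proof. by apply: derive_line => /=; apply: is_derive_eq; rewrite /GRing.scale/=; ring. Qed.
Lemma derive_snd2 (x : R * R) : is_derive x (0, 1) (fun x : R * R => x.2) (1 : R).
Proof. by apply: derive_line => /=; apply: is_derive_eq; rewrite /GRing.scale/=; ring. Qed.

Lemma bumpy_derive1 e F : bumpy e F -> exists2 F', bumpy e F' & forall x : R * R, is_derive x (1, 0) F (F' x).
Proof.
elim => [n|G bG [G' bG' dG]|G bG [G' bG' dG]|c G bG [G' bG' dG]|G H bG [G' bG' dG] bH [H' bH' dH]].
- pose b k := fun x : R * R => beta k (e ^+ 2 - (x.1 ^+ 2 + x.2 ^+ 2)).
  exists (fun x => - 2 * (x.1 * (b n.+2 x + (-1 * n%:R) * b n.+1 x))).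
    apply: bumpy_scale; apply: bumpy_X1; apply: bumpy_add; first exact: bumpy_beta.
    by apply: bumpy_scale; exact: bumpy_beta.
  move=> x; apply: derive_line => /=; apply: is_derive_eq; rewrite /GRing.scale/= /b mulr1 mulr0 !add0r; ring.
- exists (fun x => G x + x.1 * G' x); first by apply: bumpy_add => //; exact: bumpy_X1.
  move=> x; have d1 := derive_fst1 x; have d2 := dG x.
  by apply: is_derive_eq; rewrite /GRing.scale/=; ring.
- exists (fun x => x.2 * G' x); first exact: bumpy_X2.
  move=> x; have d1 := derive_snd1 x; have d2 := dG x.
  by apply: is_derive_eq; rewrite /GRing.scale/=; ring.
- exists (fun x => c * G' x); first exact: bumpy_scale.
  move=> x; have d2 := dG x.
  by apply: is_derive_eq; rewrite /GRing.scale/=; ring.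
- exists (fun x => G' x + H' x); first exact: bumpy_add.
  move=> x; have d1 := dG x; have d2 := dH x.
  by apply: is_derive_eq; rewrite /GRing.scale/=; ring.
Qed.

Lemma bumpy_derive2 e F : bumpy e F -> exists2 F', bumpy e F' & forall x : R * R, is_derive x (0, 1) F (F' x).
Proof.
elim => [n|G bG [G' bG' dG]|G bG [G' bG' dG]|c G bG [G' bG' dG]|G H bG [G' bG' dG] bH [H' bH' dH]].
- pose b k := fun x : R * R => beta k (e ^+ 2 - (x.1 ^+ 2 + x.2 ^+ 2)).
  exists (fun x => - 2 * (x.2 * (b n.+2 x + (-1 * n%:R) * b n.+1 x))).
    apply: bumpy_scale; apply: bumpy_X2; apply: bumpy_add; first exact: bumpy_beta.
    by apply: bumpy_scale; exact: bumpy_beta.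
  move=> x; apply: derive_line => /=; apply: is_derive_eq; rewrite /GRing.scale/= /b mulr1 mulr0 !add0r; ring.
- exists (fun x => x.1 * G' x); first exact: bumpy_X1.
  move=> x; have d1 := derive_fst2 x; have d2 := dG x.
  by apply: is_derive_eq; rewrite /GRing.scale/=; ring.
- exists (fun x => G x + x.2 * G' x); first by apply: bumpy_add => //; exact: bumpy_X2.
  move=> x; have d1 := derive_snd2 x; have d2 := dG x.
  by apply: is_derive_eq; rewrite /GRing.scale/=; ring.
- exists (fun x => c * G' x); first exact: bumpy_scale.
  move=> x; have d2 := dG x.
  by apply: is_derive_eq; rewrite /GRing.scale/=; ring.
- exists (fun x => G' x + H' x); first exact: bumpy_add.
  move=> x; have d1 := dG x; have d2 := dH x.
  by apply: is_derive_eq; rewrite /GRing.scale/=; ring.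
Qed.

Lemma bumpy_continuous e F : bumpy e F -> continuous F.
Proof.
elim => [n|G _ cG|G _ cG|c G _ cG|G H _ cG _ cH] x.
- apply: (@continuous_comp _ _ _ (fun x : R * R => e ^+ 2 - (x.1 ^+ 2 + x.2 ^+ 2)) (beta n)); last exact: continuous_beta.
  apply: cvgB; first exact: cvg_cst.
  by apply: cvgD; rewrite expr2; [apply: cvgM; exact: cvg_fst|apply: cvgM; exact: cvg_snd].
- by apply: cvgM; [exact: cvg_fst|exact: cG].
- by apply: cvgM; [exact: cvg_snd|exact: cG].
- by apply: cvgM; [exact: cvg_cst|exact: cG].
- by apply: cvgD; [exact: cG|exact: cH].
Qed.

Lemma bumpy_smooth e F : bumpy e F -> smooth F.
Proof.
move=> bF n; elim: n F bF => [|n IHn] F bF; split => //; try exact: bumpy_continuous bF.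
have [F1 bF1 dF1] := bumpy_derive1 bF; have [F2 bF2 dF2] := bumpy_derive2 bF.
split.
- by move=> x; exact: (@ex_derive _ _ _ _ _ _ _ (dF1 x)).
- by move=> x; exact: (@ex_derive _ _ _ _ _ _ _ (dF2 x)).
- rewrite (_ : (fun x => _) = F1); first exact: IHn.
  by apply/funext => x; exact: (@derive_val _ _ _ _ _ _ _ (dF1 x)).
- rewrite (_ : (fun x => _) = F2); first exact: IHn.
  by apply/funext => x; exact: (@derive_val _ _ _ _ _ _ _ (dF2 x)).
Qed.

Lemma bumpy_support e F x : bumpy e F -> e ^+ 2 <= x.1 ^+ 2 + x.2 ^+ 2 -> F x = 0.
Proof.
move=> + ex; elim => [n|G _ h|G _ h|c G _ h|G H _ h _ h2]; rewrite ?h ?h2 ?mulr0 ?addr0//.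
by rewrite /beta ltNge subr_le0 ex.
Qed.

Lemma bumpy_bounded e F : bumpy e F -> exists2 M, 0 <= M & forall x, `|F x| <= M.
Proof.
move=> bF; have : exists2 M, 0 <= M & forall x, x.1 ^+ 2 + x.2 ^+ 2 <= e ^+ 2 -> `|F x| <= M.
  elim: bF => [n|G _ [M M0 h]|G _ [M M0 h]|c G _ [M M0 h]|G H _ [M M0 h] _ [N N0 k]].
  - by exists n`!%:R => // x _; rewrite ger0_norm ?beta_ge0// beta_le.
  - exists (`|e| * M); first by rewrite mulr_ge0.
    move=> x xe; rewrite normrM ler_pM ?h//.
    rewrite -ler_sqr ?nnegrE// !real_normK ?num_real//; apply: le_trans xe.
    by rewrite lerDl sqr_ge0.
  - exists (`|e| * M); first by rewrite mulr_ge0.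
    move=> x xe; rewrite normrM ler_pM ?h//.
    rewrite -ler_sqr ?nnegrE// !real_normK ?num_real//; apply: le_trans xe.
    by rewrite lerDr sqr_ge0.
  - exists (`|c| * M); first by rewrite mulr_ge0.
    by move=> x xe; rewrite normrM ler_wpM2l ?h.
  - exists (M + N); first by rewrite addr_ge0.
    by move=> x xe; rewrite (le_trans (ler_normD _ _))// lerD ?h ?k.
move=> [M M0 h]; exists M => // x; have [/h//|] := leP (x.1 ^+ 2 + x.2 ^+ 2) (e ^+ 2).
by move=> /ltW /(bumpy_support bF)->; rewrite normr0.
Qed.

Lemma bumpy_measurable e F : bumpy e F -> measurable_fun setT F.
Proof.
elim => [n|G _ cG|G _ cG|c G _ cG|G H _ cG _ cH]; try (by apply: measurable_funM => //).
- apply: measurableT_comp; first by apply: continuous_measurable_fun; exact: continuous_beta.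
  apply: measurable_funB => //; apply: measurable_funD; apply: measurable_funX => //.
- by apply: measurable_funD.
Qed.

Local Notation mu := (@lebesgue_measure R).
Local Notation mu2 := (@leb2 R).

Let box (e : R) : R -> R := \1_(`[- `|e|, `|e|]%classic).

Let ibox e : mu.-integrable setT (EFin \o box e).
Proof. exact: integrable_indic_itv. Qed.

Lemma bumpy_le_box e F : bumpy e F -> exists2 M, 0 <= M &
  forall x, `|F x| <= M * (box e x.1 * box e x.2).
Proof.
move=> bF; have [M M0 h] := bumpy_bounded bF; exists M => // x.
rewrite /box !indicE.
have H (a b : R) : a \notin `[- `|e|, `|e|]%classic -> e ^+ 2 <= a ^+ 2 + b ^+ 2.
  rewrite notin_setE /= in_itv/= -ler_norml => /negP; rewrite -ltNge => ea.
  apply: (@le_trans _ _ (a ^+ 2)); last by rewrite lerDl sqr_ge0.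
  by rewrite -[a ^+ 2]real_normK ?num_real// -[e ^+ 2]real_normK ?num_real// ler_sqr ?nnegrE// ltW.
have [h1|h1] := boolP (x.1 \in _); last by rewrite mul0r mulr0 (bumpy_support bF (H _ _ h1)) normr0.
have [h2|h2] := boolP (x.2 \in _); last by rewrite !mulr0 (bumpy_support bF) ?normr0// addrC H.
by rewrite !mulr1.
Qed.

Lemma bumpy_integrable e F : bumpy e F -> mu2.-integrable setT (EFin \o F).
Proof.
move=> bF; have [M M0 h] := bumpy_le_box bF.
have c1 (z : R * R) : `|1 : R| <= 1 by rewrite normr1.
have iB := integrable_prodM (ibox e) (ibox e) (measurable_cst (1 : R)) c1.
have := integrableZl measurableT M iB; apply: le_integrable => //.
  by apply/measurable_EFinP; exact: bumpy_measurable bF.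
move=> x _; rewrite /= lee_fin mulr1; exact: le_trans (h x) (ler_norm _).
Qed.

Lemma bumpy_integrable1 e F y : bumpy e F -> mu.-integrable setT (fun x => (F (x, y))%:E).
Proof.
move=> bF; have [M M0 h] := bumpy_le_box bF.
have := integrableZl measurableT (M * box e y) (ibox e); apply: le_integrable => //.
  apply/measurable_EFinP.
  exact: (measurable_comp measurableT (@subsetT _ _) (bumpy_measurable bF) (pair2_measurable y)).
move=> x _; rewrite /= lee_fin; apply: le_trans (ler_norm _); apply: (le_trans (h _)) => /=.
by rewrite mulrA mulrAC.
Qed.

Lemma integral_derive_compact (H h : R -> R) (a : R) : 0 < a ->
  (forall x : R, is_derive x 1 H (h x)) -> continuous h -> (forall x, a <= `|x| -> H x = 0) ->
  (forall x, a <= `|x| -> h x = 0) -> \int[mu]_x h x = 0.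
Proof.
move=> a0 dH ch H0 h0.
have aa : - a < a by rewrite gtrN.
have := @Rintegral_FTC R h H (- a) a aa (fun x _ => dH x) (continuous_subspaceT ch).
rewrite !H0 ?normrN ?ger0_norm ?(ltW a0)// subrr => <-.
rewrite [RHS]Rintegral_mkcond; apply: eq_Rintegral => x _.
rewrite patchE; case: ifPn => //; rewrite notin_setE/= in_itv/= -ler_norml => /negP.
by rewrite -ltNge => /ltW /h0.
Qed.

Lemma bumpy_slice_zero e F x : bumpy e F -> `|e| <= `|x.1| -> F x = 0.
Proof.
move=> bF ex; apply: (bumpy_support bF); apply: (@le_trans _ _ (x.1 ^+ 2)); last by rewrite lerDl sqr_ge0.
by rewrite -[x.1 ^+ 2]real_normK ?num_real// -[e ^+ 2]real_normK ?num_real// ler_sqr ?nnegrE.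
Qed.

Lemma bumpy_slice_derive e F F1 (x y : R) : bumpy e F -> (forall z : R * R, is_derive z (1, 0) F (F1 z)) ->
  is_derive x 1 (fun x => F (x, y)) (F1 (x, y)).
Proof.
move=> bF dF; have [] := dF (x, y); rewrite /derivable /derive.
set g1 := fun h => h^-1 *: _ => d1 d2.
have e1 : g1 = (fun h : R => h^-1 *: (((fun x => F (x, y)) \o shift x) (h *: 1) - F (x, y))).
  apply/funext => h; rewrite /g1/=.
  have -> // : h *: (1, 0) + (x, y) = (h *: 1 + x, y) :> R * R.
  by change ((h * 1 + x, h * 0 + y) = (h * 1 + x, y)); rewrite mulr0 add0r.
by split; [rewrite /derivable -e1|rewrite /derive -e1].
Qed.

Lemma bumpy_slice_continuous e F (y : R) : bumpy e F -> continuous (fun x : R => F (x, y)).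
Proof.
move=> bF x; have [F1 _ d1] := bumpy_derive1 bF.
exact: (is_derive1_continuous (@bumpy_slice_derive e F F1 x y bF d1)).
Qed.

(** Two integrations by parts in the first variable, in one step: for fixed
    second variable the sum of the two integrands is the derivative of a compactly
    supported function. *)
Lemma bumpy_by_parts e F F1 F2 (r : R) : bumpy e F -> bumpy e F1 -> bumpy e F2 ->
  (forall z : R * R, is_derive z (1, 0) F (F1 z)) -> (forall z : R * R, is_derive z (1, 0) F1 (F2 z)) ->
  r ^+ 2 * \int[mu2]_x (F x * cos (r * x.1)) = - \int[mu2]_x (F2 x * cos (r * x.1)).
Proof.
move=> b0 b1 b2 d0 d1.
have mc : measurable_fun setT (fun x : R * R => cos (r * x.1)).
  apply: measurableT_comp; first by apply: continuous_measurable_fun; exact: continuous_cos.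
  exact: measurable_funM.
have c1 (x : R * R) : `|cos (r * x.1)| <= 1 by exact: cos_max.
have i0 := integrable_mul_bounded (bumpy_integrable b0) mc c1.
have i2 := integrable_mul_bounded (bumpy_integrable b2) mc c1.
apply/eqP; rewrite -addr_eq0 -RintegralZl//.
have i0' := integrableZl measurableT (r ^+ 2) i0.
rewrite -RintegralD//.
have iG := integrableD measurableT i0' i2.
have inner y : mu.-integrable setT (fun x => (r ^+ 2 * (F (x, y) * cos (r * x)) + F2 (x, y) * cos (r * x))%:E).
  have h G : bumpy e G -> mu.-integrable setT (fun x => (G (x, y) * cos (r * x))%:E).
    move=> bG; apply: le_integrable (bumpy_integrable1 y bG) => //.
      apply/measurable_EFinP; apply: measurable_funM.
        exact: (measurable_comp measurableT (@subsetT _ _) (bumpy_measurable bG) (pair2_measurable y)).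
      exact: (measurable_comp measurableT (@subsetT _ _) mc (pair2_measurable y)).
    by move=> x _; rewrite /= lee_fin normrM ler_piMr// cos_max.
  have := integrableD measurableT (integrableZl measurableT (r ^+ 2) (h _ b0)) (h _ b2).
  by apply: eq_integrable => // x _ /=; rewrite EFinD EFinM.
have := @Rintegral_fubini21 _ _ _ _ R mu mu (fun x => r ^+ 2 * (F x * cos (r * x.1)) + F2 x * cos (r * x.1)).
move=> <- //.
rewrite (_ : (fun y => _) = cst 0) ?/Rintegral ?integral0//; apply/funext => y.
apply: (@integral_derive_compact (fun x => F (x, y) * (r * sin (r * x)) + F1 (x, y) * cos (r * x)) _ (`|e| + 1)).
- by rewrite ltr_wpDl.
- move=> x; have e0 := @bumpy_slice_derive e F F1 x y b0 d0.
  have e1 := @bumpy_slice_derive e F1 F2 x y b1 d1.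
  apply: is_derive_eq; rewrite /GRing.scale/=; ring.
- move=> x; apply: cvgD; apply: cvgM.
  + exact: cvg_cst.
  + apply: cvgM; first exact: (@bumpy_slice_continuous e F y b0 x).
    by apply: is_derive1_continuous.
  + exact: (@bumpy_slice_continuous e F2 y b2 x).
  + by apply: is_derive1_continuous.
- move=> x ex; have ex' : `|e| <= `|x| by rewrite (le_trans _ ex)// lerDl.
  by rewrite (bumpy_slice_zero b0)// (bumpy_slice_zero b1)// !mul0r addr0.
- move=> x ex; have ex' : `|e| <= `|x| by rewrite (le_trans _ ex)// lerDl.
  by rewrite (bumpy_slice_zero b0)// (bumpy_slice_zero b2)// !mul0r mulr0 addr0.
Qed.

(** The Fourier transform, without normalizing factor, of even functions. *)
Definition cosft (F : R * R -> R) (xi : R * R) : R := \int[mu2]_x (F x * cos (dot2 x xi)).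

Lemma measurable_cos_dot2 (xi : R * R) : measurable_fun setT (fun x : R * R => cos (dot2 x xi)).
Proof.
apply: measurableT_comp; first by apply: continuous_measurable_fun; exact: continuous_cos.
by apply: measurable_funD; apply: measurable_funM.
Qed.

Lemma cosft_le F xi : mu2.-integrable setT (EFin \o F) -> `|cosft F xi| <= \int[mu2]_x `|F x|.
Proof.
move=> iF.
have iFc := integrable_mul_bounded iF (measurable_cos_dot2 xi) (fun x => cos_max _).
apply: (le_trans (le_normr_Rintegral _ _)) => //.
apply: le_Rintegral => //; [exact: integrable_norm|exact: integrable_norm|].
by move=> x _; rewrite normrM ler_piMr// cos_max.
Qed.

Lemma dot2_rotation (c s : R) (x y : R * R) : c ^+ 2 + s ^+ 2 = 1 ->
  dot2 (rotation c s x) (rotation c s y) = dot2 x y.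
Proof.
move=> cs; rewrite /dot2 /rotation/=.
transitivity ((c ^+ 2 + s ^+ 2) * (x.1 * y.1 + x.2 * y.2)); first by ring.
by rewrite cs mul1r.
Qed.

(** The cosine transform commutes with rotations, as they preserve both the
    scalar product and areas. *)
Lemma cosft_rot_invariant F : measurable_fun setT F -> rot_invariant F -> rot_invariant (cosft F).
Proof.
move=> mF rF c s xi cs; rewrite /cosft.
rewrite -(@scales_area_Rintegral _ _ _ (fun x => F x * cos (dot2 x (rotation c s xi))) ltr01 (scales_area_rotation cs)).
  by rewrite mul1r; apply: eq_Rintegral => x _; rewrite rF// dot2_rotation.
by apply: measurable_funM => //; exact: measurable_cos_dot2.
Qed.

Lemma rot_invariant_axis (F : R * R -> R) xi : rot_invariant F -> F xi = F (enorm xi, 0).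
Proof.
move=> rF; have [->|x0] := eqVneq xi (0, 0).
  by rewrite (_ : enorm (0, 0) = 0)//; apply/eqP; rewrite enorm_eq0.
have cs := unit_direction x0.
rewrite -(rF (xi.1 / enorm xi) (- (xi.2 / enorm xi))) ?sqrrN//; congr F.
have n0 : enorm xi != 0 by rewrite enorm_eq0.
rewrite /rotation; case: xi x0 cs n0 => a b /= x0 cs n0; congr pair; last by ring.
have -> : a / enorm (a, b) * a - - (b / enorm (a, b)) * b = (a ^+ 2 + b ^+ 2) / enorm (a, b) by ring.
by rewrite -(enorm_sqr (a, b)) expr2 mulfK.
Qed.

(** The bump e^(-1/(e^2 - |x|^2)), written as a member of [bumpy]. *)
Definition mollifier (e : R) : R * R -> R := fun x => beta 0 (e ^+ 2 - (x.1 ^+ 2 + x.2 ^+ 2)).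

Lemma mollifier_rot e : rot_invariant (mollifier e).
Proof. by move=> c s x cs; rewrite /mollifier -!enorm_sqr enorm_rotation. Qed.

(** By rotation invariance it suffices to bound the transform on the first axis,
    where four integrations by parts in the first variable give |xi|^(-4); the
    right-hand side is a product so that it is visibly integrable. *)
Lemma mollifier_cosft_decay e : exists2 C, 0 <= C &
  forall xi, `|cosft (mollifier e) xi| <= C * ((1 + xi.1 ^+ 2)^-1 * (1 + xi.2 ^+ 2)^-1).
Proof.
have b0 : bumpy e (mollifier e) by exact: bumpy_beta.
have [F1 b1 d1] := bumpy_derive1 b0; have [F2 b2 d2] := bumpy_derive1 b1.
have [F3 b3 d3] := bumpy_derive1 b2; have [F4 b4 d4] := bumpy_derive1 b3.
set I0 := \int[mu2]_x `|mollifier e x|; set I4 := \int[mu2]_x `|F4 x|.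
have I00 : 0 <= I0 by apply: Rintegral_ge0.
have I40 : 0 <= I4 by apply: Rintegral_ge0.
exists (2 * (I0 + I4)) => [|xi]; first by rewrite mulr_ge0// addr_ge0.
have h0 := cosft_le xi (bumpy_integrable b0).
have h4 : (enorm xi) ^+ 4 * `|cosft (mollifier e) xi| <= I4.
  have mb := bumpy_measurable b0.
  rewrite (rot_invariant_axis xi (cosft_rot_invariant mb (@mollifier_rot e))).
  have E (F : R * R -> R) : cosft F (enorm xi, 0) = \int[mu2]_x (F x * cos (enorm xi * x.1)).
    by apply: eq_Rintegral => x _; rewrite /dot2/= mulr0 addr0 (mulrC x.1).
  have := bumpy_by_parts (enorm xi) b0 b1 b2 d1 d2.
  have := bumpy_by_parts (enorm xi) b2 b3 b4 d3 d4.
  rewrite -!E => e1 e2.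
  have : (enorm xi) ^+ 4 * cosft (mollifier e) (enorm xi, 0) = cosft F4 (enorm xi, 0).
    by rewrite (_ : 4 = 2 + 2)%N// exprD -mulrA e2 mulrN e1 opprK.
  move=> E4; have := cosft_le (enorm xi, 0) (bumpy_integrable b4); rewrite -E4 normrM.
  by rewrite (@ger0_norm _ (enorm xi ^+ 4)) ?exprn_ge0 ?enorm_ge0.
set N := `|cosft _ _| in h0 h4 *.
rewrite -/I0 in h0.
have N0 : 0 <= N by exact: normr_ge0.
have e4 : enorm xi ^+ 4 = (xi.1 ^+ 2 + xi.2 ^+ 2) ^+ 2 by rewrite -enorm_sqr -exprM.
rewrite e4 in h4.
rewrite -invfM ler_pdivlMr; last by rewrite mulr_gt0// ltr_pwDl// sqr_ge0.
have := sqr_ge0 xi.1; have := sqr_ge0 xi.2; move: (xi.1 ^+ 2) (xi.2 ^+ 2) h4 => p q h4 q0 p0.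
have h5 : N * ((p + q) ^+ 2) <= I4 by rewrite mulrC.
apply: (@le_trans _ _ (N * (2 + 2 * (p + q) ^+ 2))); last by lra.
rewrite ler_wpM2l//.
have := sqr_ge0 (p - q); have := sqr_ge0 (p + q - 1); nra.
Qed.

End beta.

(** * The Poisson kernel *)

Lemma Rdominated_cvg d (T : measurableType d) (R : realType) (m : {measure set T -> \bar R})
    (f_ : nat -> T -> R) (f g : T -> R) :
  (forall n, measurable_fun setT (f_ n)) -> measurable_fun setT f ->
  m.-integrable setT (EFin \o g) -> (forall n x, `|f_ n x| <= g x) ->
  (forall x, f_ n x @[n --> \oo] --> f x) ->
  (\int[m]_x f_ n x) @[n --> \oo] --> \int[m]_x f x.
Proof.
move=> mf_ mf ig fg cf.
have cE (x : T) : (EFin (f_ n x) @[n --> \oo] --> EFin (f x))%E.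
  by apply: cvg_EFin; [exact: nearW|exact: cf].
have [if_ _ h] := @dominated_convergence _ _ R m setT measurableT (fun n => EFin \o f_ n) (EFin \o f) (EFin \o g)
  (fun n => (measurable_EFinP _ _).2 (mf_ n)) ((measurable_EFinP _ _).2 mf)
  (aeW m (fun x _ => cE x)) ig
  (aeW m (fun x n _ => fg n x)).
apply: fine_cvg; rewrite fineK//.
exact: integrable_fin_num.
Qed.

Section poisson.
Context {R : realType}.
Local Notation mu := (@lebesgue_measure R).
Local Notation mu2 := (@leb2 R).

Lemma ge0_integral_opp (f : R -> \bar R) :
  measurable_fun setT f -> (forall x, 0 <= f x)%E ->
  (\int[mu]_x f (- x)%R = \int[mu]_x f x)%E.
Proof.
move=> mf f0.
have mN : measurable_fun setT (-%R : R -> measurableTypeR R) by exact: oppr_measurable.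
have := @ge0_integral_pushforward _ _ (measurableTypeR R) (measurableTypeR R) R _ mN mu setT f measurableT mf (fun x _ => f0 x).
rewrite preimage_setT => <-.
by apply: eq_measure_integral => A mA _; exact: lebesgue_measureN.
Qed.

Lemma odd_Rintegral1 (g : R -> R) : mu.-integrable setT (EFin \o g) ->
  (forall x, g (- x) = - g x) -> \int[mu]_x g x = 0.
Proof.
move=> ig gN; have mg := measurable_int _ ig.
rewrite /Rintegral (integralE mu setT (EFin \o g)).
rewrite -(ge0_integral_opp (measurable_funepos mg) (fun x => funepos_ge0 _ x)).
have -> : (fun x : R => (EFin \o g)^\+%E (- x)) = (EFin \o g)^\-%E.
  by apply/funext => x; rewrite funeposE funenegE/= gN.
by rewrite subee//; apply: integrable_fin_num => //; exact: integrable_funeneg.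
Qed.

Lemma integral_oneDX2V : (\int[mu]_x ((1 + x ^+ 2)^-1)%:E = pi%:E)%E.
Proof.
rewrite (ge0_even_integral_FTC (F := atan) (l := pi / 2)).
- by rewrite atan0 subr0; congr EFin; rewrite mulrCA mulfV ?mulr1.
- by move=> x; rewrite invr_ge0 addr_ge0// sqr_ge0.
- by move=> x; rewrite sqrrN.
- exact: continuous_oneDsqrV.
- exact: cvgy_atan.
Qed.

Lemma integrable_oneDX2V : mu.-integrable setT (EFin \o (fun x : R => (1 + x ^+ 2)^-1)).
Proof.
apply/integrableP; split.
  by apply/measurable_EFinP; apply: continuous_measurable_fun; exact: continuous_oneDsqrV.
rewrite (_ : \int[mu]_x _ = pi%:E)%E ?ltry// -integral_oneDX2V; apply: eq_integral => x _ /=.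
by rewrite ger0_norm// invr_ge0 addr_ge0// sqr_ge0.
Qed.

(** The convergence factor, whose transform is the Poisson kernel of the line.
    It is used rather than a Gaussian since its transform is elementary. *)
Definition expabs (e x : R) := expR (- (e * `|x|)).

Lemma measurable_expabs e : measurable_fun setT (expabs e).
Proof.
by apply: measurableT_comp => //; apply: measurableT_comp => //; apply: measurable_funM.
Qed.

Lemma continuous_expabs e : continuous (expabs e).
Proof.
move=> x; apply: (@continuous_comp _ _ _ (fun x : R => - (e * `|x|)) expR); last exact: continuous_expR.
by apply: cvgN; apply: cvgM; [exact: cvg_cst|exact: norm_continuous].
Qed.

Lemma expabs_ge0 e x : 0 <= expabs e x. Proof. exact: expR_ge0. Qed.

(** The summand [1] makes the integrand nonnegative, so that its integrability
    need not be known beforehand; [expabs_cos] subtracts its contribution. *)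
Lemma integral_expabs_oneDcos (e z : R) : 0 < e ->
  (\int[mu]_x (expabs e x * (1 + cos (z * x)))%:E = (2 * (e^-1 + e / (e ^+ 2 + z ^+ 2)))%:E)%E.
Proof.
move=> e0.
have D0 : 0 < e ^+ 2 + z ^+ 2 by rewrite ltr_wpDr ?sqr_ge0// exprn_gt0.
pose F (x : R) := expR (- (e * x)) * (- e^-1 + (- e * cos (z * x) + z * sin (z * x)) / (e ^+ 2 + z ^+ 2)).
have dF (x : R) : 0 <= x -> is_derive x 1 F (expabs e x * (1 + cos (z * x))).
  move=> x0; rewrite /expabs ger0_norm//.
  apply: is_derive_eq; rewrite /GRing.scale/=; field.
  by rewrite (gt_eqF e0) (gt_eqF D0).
rewrite (ge0_even_integral_FTC (l := 0) dF).
- congr EFin; rewrite /F !mulr0 oppr0 expR0 cos0 sin0; field.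
  by rewrite (gt_eqF e0) (gt_eqF D0).
- by move=> x; rewrite mulr_ge0 ?expabs_ge0// -lerBlDl sub0r cos_geN1.
- by move=> x; rewrite /expabs normrN mulrN cosN.
- have cn : continuous (fun x : R => 1 + cos (z * x)).
    by move=> x; apply: is_derive1_continuous.
  by move=> x; apply: cvgM; [exact: continuous_expabs|exact: cn].
- have hb x : `|F x| <= expR (- (e * x)) * (e^-1 + (e + `|z|) / (e ^+ 2 + z ^+ 2)).
    rewrite normrM ger0_norm ?expR_ge0// ler_wpM2l ?expR_ge0//.
    apply: (le_trans (ler_normD _ _)); rewrite normrN (@ger0_norm _ e^-1) ?invr_ge0 ?(ltW e0)//.
    rewrite lerD2l normrM (@ger0_norm _ _^-1) ?invr_ge0 ?(ltW D0)// ler_pM2r ?invr_gt0//.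
    apply: (le_trans (ler_normD _ _)); rewrite !normrM normrN (@ger0_norm _ e) ?(ltW e0)//.
    by rewrite lerD// ler_piMr ?cos_max ?sin_max// ltW.
  have hc : expR (- (e * x)) * (e^-1 + (e + `|z|) / (e ^+ 2 + z ^+ 2)) @[x --> +oo] --> (0 : R).
    rewrite -(mul0r (e^-1 + (e + `|z|) / (e ^+ 2 + z ^+ 2))); apply: cvgM; last exact: cvg_cst.
    apply: (@cvg_comp _ _ _ (fun x => e * x) (fun x => expR (- x))); last exact: cvgr_expR.
    apply/cvgryPge => A; near=> x.
    rewrite -ler_pdivrMl//; near: x; apply: nbhs_pinfty_ge; exact: num_real.
  by apply: norm_cvg0; apply: (@squeeze_cvgr _ _ _ _ (cst 0) _ _ _ _ _ hc) => //; [apply: nearW => x; rewrite normr_ge0 hb|exact: cvg_cst].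
Unshelve. all: by end_near. Qed.

Lemma integrable_expabs (e : R) : 0 < e -> mu.-integrable setT (EFin \o expabs e).
Proof.
move=> e0; apply/integrableP; split; first by apply/measurable_EFinP; exact: measurable_expabs.
apply: (@le_lt_trans _ _ (\int[mu]_x (expabs e x * (1 + cos (0 * x)))%:E)%E).
  apply: ge0_le_integral => //.
  - by apply: measurableT_comp => //; apply/measurable_EFinP; exact: measurable_expabs.
  - apply/measurable_EFinP; apply: measurable_funM; first exact: measurable_expabs.
    rewrite (_ : (fun x => _) = cst 2)//; apply/funext => x; rewrite mul0r cos0//.
  - move=> x _; rewrite /= lee_fin ger0_norm ?expabs_ge0// mul0r cos0 ler_peMr ?expabs_ge0// lerDl//.
by rewrite integral_expabs_oneDcos// ltry.
Qed.

Let mcos z : measurable_fun setT (fun x : R => cos (z * x)).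
Proof. by apply: continuous_measurable_fun => x; apply: is_derive1_continuous. Qed.
Let msin z : measurable_fun setT (fun x : R => sin (z * x)).
Proof. by apply: continuous_measurable_fun => x; apply: is_derive1_continuous. Qed.

Lemma integrable_expabsM (e : R) (c : R -> R) : 0 < e -> measurable_fun setT c -> (forall x, `|c x| <= 1) ->
  mu.-integrable setT (fun x => (expabs e x * c x)%:E).
Proof.
move=> e0 mc c1; have := integrable_expabs e0; apply: le_integrable => //.
  by apply/measurable_EFinP; apply: measurable_funM => //; exact: measurable_expabs.
by move=> x _; rewrite /= lee_fin normrM ler_piMr.
Qed.

Lemma expabs_cos (e z : R) : 0 < e ->
  \int[mu]_x (expabs e x * cos (z * x)) = 2 * e / (e ^+ 2 + z ^+ 2).
Proof.
move=> e0; have ie := integrable_expabs e0.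
have ic := integrable_expabsM e0 (mcos z) (fun x => cos_max _).
have D0 : 0 < e ^+ 2 + z ^+ 2 by rewrite ltr_wpDr ?sqr_ge0// exprn_gt0.
have h w : \int[mu]_x (expabs e x) + \int[mu]_x (expabs e x * cos (w * x)) = 2 * (e^-1 + e / (e ^+ 2 + w ^+ 2)).
  rewrite -RintegralD//; last exact: (integrable_expabsM e0 (mcos w) (fun x => cos_max _)).
  rewrite -[RHS]/(fine (_%:E)) -integral_expabs_oneDcos//; congr fine; apply: eq_integral => x _.
  by rewrite mulrDr mulr1.
have := h 0; have := h z.
under [X in _ -> _ + X = _ -> _]eq_Rintegral do rewrite mul0r cos0 mulr1.
set I := \int[mu]_x expabs e x => h1 h2.
have -> : \int[mu]_x (expabs e x * cos (z * x)) = 2 * (e^-1 + e / (e ^+ 2 + z ^+ 2)) - I by rewrite -h1; ring.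
have -> : I = 2 * e^-1.
  have : I + I = 4 * e^-1 by rewrite h2; field; exact: lt0r_neq0.
  lra.
by field; rewrite (gt_eqF e0) (gt_eqF D0).
Qed.

Lemma expabs_sin (e z : R) : 0 < e -> \int[mu]_x (expabs e x * sin (z * x)) = 0.
Proof.
move=> e0; apply: odd_Rintegral1.
  exact: (integrable_expabsM e0 (msin z) (fun x => sin_max _)).
by move=> x; rewrite /expabs normrN mulrN sinN mulrN.
Qed.

Definition expabs2 (e : R) (x : R * R) := expabs e x.1 * expabs e x.2.

Lemma integrable_expabs2 (e : R) : 0 < e -> mu2.-integrable setT (EFin \o expabs2 e).
Proof.
move=> e0; have c1 (z : R * R) : `|1 : R| <= 1 by rewrite normr1.
have := integrable_prodM (integrable_expabs e0) (integrable_expabs e0) (measurable_cst (1 : R)) c1.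
by apply: eq_integrable => // x _ /=; rewrite mulr1.
Qed.

(** The double integral splits since cos(x_1 z_1 + x_2 z_2) expands into products
    and the product of sines integrates to 0. *)
Lemma poisson_kernel (e : R) (z : R * R) : 0 < e ->
  cosft (expabs2 e) z = (2 * e / (e ^+ 2 + z.1 ^+ 2)) * (2 * e / (e ^+ 2 + z.2 ^+ 2)).
Proof.
move=> e0.
have iG := integrable_mul_bounded (integrable_expabs2 e0) (measurable_cos_dot2 z) (fun x => cos_max _).
have i2 (x : R) : mu.-integrable setT (fun y => (expabs2 e (x, y) * cos (dot2 (x, y) z))%:E).
  have mc : measurable_fun setT (fun y : R => cos (dot2 (x, y) z)).
    exact: (measurable_comp measurableT (@subsetT _ _) (measurable_cos_dot2 z) (pair1_measurable x)).
  have := integrableZl measurableT (expabs e x) (integrable_expabsM e0 mc (fun y => cos_max _)).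
  by apply: eq_integrable => // y _ /=; rewrite /expabs2/= -EFinM mulrA.
rewrite /cosft -(@Rintegral_fubini12 _ _ _ _ R mu mu _ iG i2).
transitivity (\int[mu]_x (expabs e x * cos (z.1 * x) * (2 * e / (e ^+ 2 + z.2 ^+ 2)))).
  apply: eq_Rintegral => x _.
  rewrite -expabs_cos//.
  have ic := integrable_expabsM e0 (mcos z.2) (fun y => cos_max _).
  have is_ := integrable_expabsM e0 (msin z.2) (fun y => sin_max _).
  rewrite -[RHS]subr0 -(mulr0 (expabs e x * sin (z.1 * x))) -(expabs_sin z.2 e0).
  rewrite -RintegralZl// -RintegralZl// -RintegralB//; last 2 first.
  - exact: (integrableZl measurableT (expabs e x * cos (z.1 * x)) ic).
  - exact: (integrableZl measurableT (expabs e x * sin (z.1 * x)) is_).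
  apply: eq_Rintegral => y _; rewrite /expabs2 /dot2/= cosD (mulrC x) (mulrC y); ring.
rewrite RintegralZr ?expabs_cos//.
exact: (integrable_expabsM e0 (mcos z.1) (fun y => cos_max _)).
Qed.

End poisson.

(** * Fourier inversion *)

Section inversion.
Context {R : realType}.
Local Notation mu := (@lebesgue_measure R).
Local Notation mu2 := (@leb2 R).
Implicit Types (F G : R * R -> R).

Lemma measurable_cos_dot2_pair :
  measurable_fun setT (fun z : (R * R) * (R * R) => cos (dot2 z.1 z.2)).
Proof.
apply: measurableT_comp; first by apply: continuous_measurable_fun; exact: continuous_cos.
by apply: measurable_funD; apply: measurable_funM; apply: measurableT_comp.
Qed.

Lemma dot2C (x y : R * R) : dot2 x y = dot2 y x.
Proof. by rewrite /dot2 mulrC (mulrC x.2). Qed.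

Section multiplication.
Variables F G : R * R -> R.
Hypotheses (iF : mu2.-integrable setT (EFin \o F)) (iG : mu2.-integrable setT (EFin \o G)).

Let K (z : (R * R) * (R * R)) : R := F z.1 * G z.2 * cos (dot2 z.1 z.2).

Let iK : (mu2 \x mu2)%E.-integrable setT (EFin \o K).
Proof. exact: (integrable_prodM iF iG measurable_cos_dot2_pair (fun z => cos_max _)). Qed.

Let iK1 xi : mu2.-integrable setT (fun x => (K (x, xi))%:E).
Proof.
have := integrableZl measurableT (G xi) (integrable_mul_bounded iF (measurable_cos_dot2 xi) (fun x => cos_max _)).
by apply: eq_integrable => // x _; rewrite /K/= -EFinM; congr EFin; ring.
Qed.

Let iK2 x : mu2.-integrable setT (fun xi => (K (x, xi))%:E).
Proof.
have := integrableZl measurableT (F x) (integrable_mul_bounded iG (measurable_cos_dot2 x) (fun x => cos_max _)).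
by apply: eq_integrable => // y _; rewrite /K/= -EFinM dot2C; congr EFin; ring.
Qed.

Let K1E xi : \int[mu2]_x K (x, xi) = G xi * cosft F xi.
Proof.
rewrite /cosft -RintegralZl//; last first.
  exact: (integrable_mul_bounded iF (measurable_cos_dot2 xi) (fun x => cos_max _)).
by apply: eq_Rintegral => x _; rewrite /K/=; ring.
Qed.

Let K2E x : \int[mu2]_xi K (x, xi) = F x * cosft G x.
Proof.
rewrite /cosft -RintegralZl//; last first.
  exact: (integrable_mul_bounded iG (measurable_cos_dot2 x) (fun x => cos_max _)).
by apply: eq_Rintegral => y _; rewrite /K/= (dot2C y); ring.
Qed.

Lemma measurable_mul_cosft : measurable_fun setT (fun xi => G xi * cosft F xi).
Proof.
rewrite -(funext K1E : (fun xi => \int[mu2]_x K (x, xi)) = _).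
exact: (measurable_Rint1 iK iK1).
Qed.

(** Fubini for F(x) G(xi) cos(x . xi). *)
Lemma multiplication_formula :
  \int[mu2]_xi (G xi * cosft F xi) = \int[mu2]_x (F x * cosft G x).
Proof.
transitivity (\int[mu2]_xi \int[mu2]_x K (x, xi)).
  by apply: eq_Rintegral => xi _; rewrite K1E.
transitivity (\int[mu2]_x \int[mu2]_xi K (x, xi)); last first.
  by apply: eq_Rintegral => x _; rewrite K2E.
by rewrite (Rintegral_fubini21 iK iK1) (Rintegral_fubini12 iK iK2).
Qed.

End multiplication.

(** Fubini gives measurability once the transform is multiplied by an integrable
    weight, which can be divided out as it never vanishes. *)
Lemma measurable_cosft F : mu2.-integrable setT (EFin \o F) -> measurable_fun setT (cosft F).
Proof.
move=> iF; have h := measurable_mul_cosft iF (integrable_expabs2 ltr01).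
have -> : cosft F = fun xi => (expR `|xi.1| * expR `|xi.2|) * (expabs2 1 xi * cosft F xi).
  apply/funext => xi; rewrite /expabs2 /expabs !mul1r -expRD mulrA -!expRD.
  by rewrite (_ : _ + _ = 0) ?expR0 ?mul1r//; ring.
apply: measurable_funM => //; apply: measurable_funM.
  by apply: measurableT_comp => //; apply: measurableT_comp.
by apply: measurableT_comp => //; apply: measurableT_comp.
Qed.

Lemma Rintegral_opp F : measurable_fun setT F ->
  \int[mu2]_x F (- x.1, - x.2) = \int[mu2]_x F x.
Proof.
move=> mF; have cs : (-1) ^+ 2 + 0 ^+ 2 = 1 :> R by ring.
rewrite -(@scales_area_Rintegral _ _ _ F ltr01 (scales_area_rotation cs) mF) mul1r.
apply: eq_Rintegral => x _; rewrite /rotation; congr F; congr pair; ring.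
Qed.

Lemma integrable_cauchy2 :
  mu2.-integrable setT (EFin \o (fun x : R * R => (1 + x.1 ^+ 2)^-1 * (1 + x.2 ^+ 2)^-1)).
Proof.
have c1 (z : R * R) : `|1 : R| <= 1 by rewrite normr1.
have := integrable_prodM integrable_oneDX2V integrable_oneDX2V (measurable_cst (1 : R)) c1.
by apply: eq_integrable => // x _ /=; rewrite mulr1.
Qed.

Lemma integral_cauchy2 :
  \int[mu2]_x ((1 + x.1 ^+ 2)^-1 * (1 + x.2 ^+ 2)^-1) = pi ^+ 2 :> R.
Proof.
have ii := @integrable_oneDX2V R.
have I1 : \int[mu]_x ((1 + x ^+ 2)^-1) = pi :> R by rewrite /Rintegral integral_oneDX2V.
rewrite -(@Rintegral_fubini12 _ _ _ _ R mu mu _ integrable_cauchy2); last first.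
  move=> x; have := integrableZl measurableT ((1 + x ^+ 2)^-1) ii.
  by apply: eq_integrable.
transitivity (\int[mu]_x ((1 + x ^+ 2)^-1 * pi)); last by rewrite RintegralZr// I1 expr2.
by apply: eq_Rintegral => x _ /=; rewrite RintegralZl// I1.
Qed.

Lemma mollifier_cosft_integrable e : mu2.-integrable setT (EFin \o cosft (mollifier e)).
Proof.
have [C C0 hC] := @mollifier_cosft_decay R e.
have := integrableZl measurableT C integrable_cauchy2; apply: le_integrable => //.
  apply/measurable_EFinP; apply: measurable_cosft.
  exact: (bumpy_integrable (bumpy_beta _ _)).
move=> x _; rewrite /= lee_fin [leRHS]ger0_norm ?hC//.
by rewrite !mulr_ge0// invr_ge0 addr_ge0// sqr_ge0.
Qed.

Lemma dot2_sub (xi x y : R * R) : dot2 xi (x.1 - y.1, x.2 - y.2) = dot2 xi x - dot2 xi y.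
Proof. by rewrite /dot2/=; ring. Qed.

Lemma cosft_opp F (x : R * R) : cosft F (- x.1, - x.2) = cosft F x.
Proof.
apply: eq_Rintegral => y _.
by rewrite (_ : dot2 y (- x.1, - x.2) = - dot2 y x) ?cosN// /dot2/=; ring.
Qed.

(** Product formula for cosines. *)
Lemma cosft_modulated F (x y : R * R) : mu2.-integrable setT (EFin \o F) ->
  cosft (fun xi => F xi * cos (dot2 xi x)) y =
  (cosft F (y.1 - x.1, y.2 - x.2) + cosft F (- y.1 - x.1, - y.2 - x.2)) / 2.
Proof.
move=> iF; rewrite /cosft -RintegralD//; last 2 first.
- exact: (integrable_mul_bounded iF (measurable_cos_dot2 _) (fun x => cos_max _)).
- exact: (integrable_mul_bounded iF (measurable_cos_dot2 _) (fun x => cos_max _)).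
rewrite -RintegralZr//; last first.
  exact: (integrableD measurableT
    (integrable_mul_bounded iF (measurable_cos_dot2 _) (fun x => cos_max _))
    (integrable_mul_bounded iF (measurable_cos_dot2 _) (fun x => cos_max _))).
apply: eq_Rintegral => xi _.
have -> : dot2 xi (y.1 - x.1, y.2 - x.2) = dot2 xi y - dot2 xi x by rewrite dot2_sub.
have -> : dot2 xi (- y.1 - x.1, - y.2 - x.2) = - (dot2 xi y + dot2 xi x) by rewrite /dot2/=; ring.
by rewrite cosN cosB cosD; field.
Qed.

Section inversion_formula.
Variables (F : R * R -> R) (M : R) (x : R * R).
Hypotheses (iF : mu2.-integrable setT (EFin \o F)) (cF : continuous F)
  (bF : forall y, `|F y| <= M) (eF : forall y, F (- y.1, - y.2) = F y)
  (iFF : mu2.-integrable setT (EFin \o cosft F)).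

Let eps n : R := n.+1%:R^-1.
Let eps0 n : 0 < eps n. Proof. by rewrite invr_gt0. Qed.

Let A n := \int[mu2]_xi (cosft F xi * cos (dot2 xi x) * expabs2 (eps n) xi).

Let expabs2_ge0 e (y : R * R) : 0 <= expabs2 e y.
Proof. by rewrite mulr_ge0// expabs_ge0. Qed.

Let expabs2_le1 n (y : R * R) : expabs2 (eps n) y <= 1.
Proof.
rewrite /expabs2 -[leRHS]mulr1 ler_pM ?expabs_ge0//;
by rewrite -expR0 ler_expR oppr_le0 mulr_ge0// ltW.
Qed.

Let eps_cvg : eps n @[n --> \oo] --> (0 : R).
Proof. exact: cvg_harmonic. Qed.

Let A_cvg : A n @[n --> \oo] --> cosft (cosft F) x.
Proof.
have mFF := integrable_measurable iFF.
have mc := measurable_cos_dot2 x.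
apply: (@Rdominated_cvg _ _ R mu2 _ _ (fun xi => `|cosft F xi|)).
- move=> n; apply: measurable_funM; first exact: measurable_funM.
  exact: (integrable_measurable (integrable_expabs2 (eps0 n))).
- exact: measurable_funM.
- exact: integrable_norm.
- move=> n xi; rewrite normrM (ger0_norm (expabs2_ge0 (eps n) xi)) normrM -mulrA ler_piMr//.
  by rewrite -[leRHS]mulr1 ler_pM// ?cos_max// expabs2_ge0.
- move=> xi; rewrite -[X in _ --> X]mulr1; apply: cvgM; first exact: cvg_cst.
  have h (r : R) : expabs (eps n) r @[n --> \oo] --> (1 : R).
    rewrite -[X in _ --> X]expR0 /expabs; apply: continuous_cvg; first exact: continuous_expR.
    by rewrite -oppr0 -(mul0r `|r|); apply: cvgN; apply: cvgM; [exact: eps_cvg|exact: cvg_cst].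
  by rewrite -[X in _ --> X]mulr1; apply: cvgM.
Qed.

Let W n := cosft (expabs2 (eps n)).

Let A_kernel n : A n = \int[mu2]_y (F y * W n (y.1 - x.1, y.2 - x.2)).
Proof.
have mF := integrable_measurable iF.
have iw := integrable_expabs2 (eps0 n).
have iwc := integrable_mul_bounded iw (measurable_cos_dot2 x) (fun x => cos_max _).
have mW (b1 b2 : R) : measurable_fun setT (fun y : R * R => W n (y.1 + b1, y.2 + b2)).
  apply: (measurableT_comp (measurable_cosft iw)).
  by apply: measurable_fun_pair => /=; apply: measurable_funD.
pose C := \int[mu2]_y `|expabs2 (eps n) y|.
have bW y : `|W n y| <= C by exact: cosft_le.
have C0 : 0 <= C by exact: le_trans (normr_ge0 _) (bW (0, 0)).
have iFW (b1 b2 : R) : mu2.-integrable setT (EFin \o (fun y => F y * W n (y.1 + b1, y.2 + b2))).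
  have := integrableZl measurableT C (integrable_norm iF); apply: le_integrable => //.
    by apply/measurable_EFinP; apply: measurable_funM; [exact: mF|exact: mW].
  move=> y _; rewrite /= lee_fin normrM [leRHS]ger0_norm ?mulr_ge0// mulrC.
  by rewrite ler_wpM2r.
transitivity (\int[mu2]_xi (expabs2 (eps n) xi * cos (dot2 xi x) * cosft F xi)).
  by apply: eq_Rintegral => xi _; ring.
rewrite (multiplication_formula iF iwc).
transitivity (\int[mu2]_y ((F y * W n (y.1 - x.1, y.2 - x.2) + F y * W n (y.1 + x.1, y.2 + x.2)) / 2)).
  apply: eq_Rintegral => y _; rewrite cosft_modulated//.
  have -> : W n (y.1 + x.1, y.2 + x.2) = W n (- y.1 - x.1, - y.2 - x.2).
    by rewrite -[LHS]cosft_opp/=; congr (W n (_, _)); ring.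
  by rewrite -mulrDr mulrA.
rewrite RintegralZr//; last exact: (integrableD measurableT (iFW _ _) (iFW _ _)).
rewrite RintegralD//.
have <- : \int[mu2]_y (F y * W n (y.1 - x.1, y.2 - x.2)) = \int[mu2]_y (F y * W n (y.1 + x.1, y.2 + x.2)).
  rewrite -Rintegral_opp/=; last exact: (integrable_measurable (iFW _ _)).
  apply: eq_Rintegral => y _; rewrite eF; congr (_ * _).
  by rewrite -[RHS]cosft_opp/=; congr (W n (_, _)); ring.
by field.
Qed.

Let P (u : R * R) : R := (1 + u.1 ^+ 2)^-1 * (1 + u.2 ^+ 2)^-1.

Let mP : measurable_fun setT P.
Proof. exact: (integrable_measurable integrable_cauchy2). Qed.

Let P0 u : 0 <= P u.
Proof. by rewrite mulr_ge0// invr_ge0 addr_ge0// sqr_ge0. Qed.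

Let A_rescaled n : A n = \int[mu2]_u (F (eps n * u.1 + x.1, eps n * u.2 + x.2) * (4 * P u)).
Proof.
have mF := integrable_measurable iF.
have iw := integrable_expabs2 (eps0 n).
have mW : measurable_fun setT (fun y : R * R => W n (y.1 - x.1, y.2 - x.2)).
  apply: (measurableT_comp (measurable_cosft iw)).
  by apply: measurable_fun_pair => /=; apply: measurable_funB.
have e2 : 0 < eps n ^+ 2 by rewrite exprn_gt0.
rewrite A_kernel -(scales_area_Rintegral e2 (scales_area_homothety x.1 x.2 (eps0 n))) /=; last exact: measurable_funM.
have iFT := scales_area_integrable e2 (scales_area_homothety x.1 x.2 (eps0 n)) iF.
rewrite -RintegralZl//; last first.
  have := integrableZl measurableT (\int[mu2]_y `|expabs2 (eps n) y|) (integrable_norm iFT); apply: le_integrable => //.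
    apply/measurable_EFinP; apply: measurable_funM; first exact: (integrable_measurable iFT).
    apply: (measurableT_comp (measurable_cosft iw)).
    apply: measurable_fun_pair => /=; apply: measurable_funB => //; apply: measurable_funD => //; exact: measurable_funM.
  move=> y _; rewrite /= lee_fin normrM [leRHS]ger0_norm ?mulr_ge0// ?Rintegral_ge0// mulrC.
  by rewrite ler_wpM2r// cosft_le.
apply: eq_Rintegral => u _ /=; rewrite mulrCA; congr (_ * _).
rewrite !addrK /W poisson_kernel//= /P.
have h (v : R) : eps n ^+ 2 + (eps n * v) ^+ 2 = eps n ^+ 2 * (1 + v ^+ 2) by ring.
rewrite !h.
have h1 (v : R) : 1 + v ^+ 2 != 0 by rewrite gt_eqF// ltr_pwDl// sqr_ge0.
by field; rewrite ?h1 ?gt_eqF.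
Qed.

(** Multiply [cosft F] by a convergence factor, move the transform to the other
    side, and let the factor tend to 1: the kernel that appears is, after rescaling,
    a fixed integrable function of mass (2 pi)^2. *)
Lemma cosft_inversion : cosft (cosft F) x = (2 * pi) ^+ 2 * F x.
Proof.
rewrite -(cvg_lim _ A_cvg)//; apply: cvg_lim => //.
have -> : (2 * pi) ^+ 2 * F x = \int[mu2]_u (F x * (4 * P u)).
  rewrite RintegralZl//; last exact: (integrableZl measurableT 4 integrable_cauchy2).
  rewrite RintegralZl//; last exact: integrable_cauchy2.
  by rewrite integral_cauchy2; ring.
rewrite (funext A_rescaled).
have mF := integrable_measurable iF.
apply: (@Rdominated_cvg _ _ R mu2 _ _ (fun u => M * (4 * P u))).
- move=> n; apply: measurable_funM; last exact: measurable_funM.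
  apply: measurableT_comp => //; apply: measurable_fun_pair => /=; apply: measurable_funD => //; exact: measurable_funM.
- by apply: measurable_funM => //; exact: measurable_funM.
- exact: (integrableZl measurableT M (integrableZl measurableT 4 integrable_cauchy2)).
- move=> n u; have P4 : 0 <= 4 * P u by rewrite mulr_ge0.
  by rewrite normrM (ger0_norm P4); apply: ler_wpM2r.
- move=> u; apply: cvgM; last exact: cvg_cst.
  rewrite (_ : F x = F (0 * u.1 + x.1, 0 * u.2 + x.2)); last by rewrite !mul0r !add0r -surjective_pairing.
  apply: continuous_cvg; first exact: cF.
  have h (v b : R) : eps n * v + b @[n --> \oo] --> 0 * v + b.
    by apply: cvgD; [apply: cvgM; [exact: eps_cvg|exact: cvg_cst]|exact: cvg_cst].
  exact: (cvg_pair (h _ _) (h _ _)).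
Qed.

End inversion_formula.

Lemma mollifier_inversion e (x : R * R) :
  cosft (cosft (mollifier e)) x = (2 * pi) ^+ 2 * mollifier e x.
Proof.
have b0 : bumpy e (mollifier e) by exact: bumpy_beta.
have [M _ hM] := bumpy_bounded b0.
apply: (@cosft_inversion _ M) => //.
- exact: bumpy_integrable b0.
- exact: bumpy_continuous b0.
- by move=> y; rewrite /mollifier/= !sqrrN.
- exact: mollifier_cosft_integrable.
Qed.

End inversion.

(** * Approximation of the identity *)

Section approximate_identity.
Context {R : realType}.
Local Notation mu := (@lebesgue_measure R).
Local Notation mu2 := (@leb2 R).

(** Rounding the first coordinate down to a multiple of 1/n gives functions that
    are measurable slice by slice over countably many slabs, and that converge to
    [h]. *)
Lemma continuous_measurable2 (h : R * R -> R) : continuous h -> measurable_fun setT h.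
Proof.
move=> ch.
pose p n (r : R) : R := (Num.floor (n.+1%:R * r))%:~R / n.+1%:R.
apply: (@measurable_fun_cvg _ _ R setT (fun n x => h (p n x.1, x.2))).
  move=> n _ A mA; rewrite setTI.
  pose S (k : int) : set (R * R) := [set x | (n.+1%:R * x.1) \in `[k%:~R, (k + 1)%:~R[%R].
  rewrite (_ : _ @^-1` _ = \bigcup_k (S k `&` (fun x : R * R => h (k%:~R / n.+1%:R, x.2)) @^-1` A)).
    apply: countable_bigcupT_measurable => [|k]; first exact: countableP.
    apply: measurableI.
      have mf : measurable_fun setT (fun x : R * R => n.+1%:R * x.1) by exact: measurable_funM.
      have := mf measurableT `[k%:~R, (k + 1)%:~R[%classic (measurable_itv _).
      by rewrite setTI.
    have mg : measurable_fun setT (fun x : R * R => h (k%:~R / n.+1%:R, x.2)).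
      apply: (@measurableT_comp _ _ _ _ _ _ (fun y : R => h (k%:~R / n.+1%:R, y))) => //.
      have cp : continuous (fun y : R => (k%:~R / n.+1%:R : R, y)).
        move=> y; have c1 : (fun _ : R => k%:~R / n.+1%:R : R) z @[z --> y] --> (k%:~R / n.+1%:R : R) by exact: cvg_cst.
        have c2 : id z @[z --> y] --> y by exact: cvg_id.
        exact: (cvg_pair c1 c2).
      apply: continuous_measurable_fun => y.
      exact: (continuous_comp (cp y) (ch _)).
    by have := mg measurableT _ mA; rewrite setTI.
  apply/seteqP; split => [x /= Ax|x [k _ [/= Sk]]].
    exists (Num.floor (n.+1%:R * x.1)) => //; split => //.
    by rewrite /S/= in_itv/= floor_itv.
  by rewrite /p; have /eqP -> : Num.floor (n.+1%:R * x.1) == k by rewrite floor_eq; move: Sk; rewrite /S/= in_itv.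
move=> x _; rewrite [X in _ --> h X]surjective_pairing.
have hp : p n x.1 @[n --> \oo] --> x.1.
  apply: (@squeeze_cvgr _ _ _ _ (fun n => x.1 - n.+1%:R^-1) (cst x.1)).
  - apply: nearW => n; rewrite /p.
    have n0 : 0 < n.+1%:R :> R by [].
    have /andP[h1 h2] := floor_itv (n.+1%:R * x.1).
    rewrite ler_pdivlMr// ler_pdivrMr// (mulrC _ n.+1%:R) mulrBr mulfV ?gt_eqF//.
    rewrite /cst (mulrC x.1) h1 andbT lerBlDr.
    by rewrite intrD in h2; exact: ltW.
  - rewrite -[X in _ --> X]subr0; apply: cvgB; [exact: cvg_cst|exact: cvg_harmonic].
  - exact: cvg_cst.
apply: continuous_cvg; first exact: ch.
have c2 : (fun _ : nat => x.2) n @[n --> \oo] --> x.2 by exact: cvg_cst.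
exact: (cvg_pair hp c2).
Qed.

Lemma mollifier_ge0 e (x : R * R) : 0 <= mollifier e x. Proof. exact: beta_ge0. Qed.

Lemma mollifier_integrable (e : R) : mu2.-integrable setT (EFin \o mollifier e).
Proof. exact: bumpy_integrable (bumpy_beta _ _). Qed.

(** If the mass were 0, the transform of the bump would vanish, and by inversion
    so would the bump at the origin. *)
Lemma mollifier_mass (e : R) : 0 < e -> 0 < \int[mu2]_x mollifier e x.
Proof.
move=> e0; rewrite lt_neqAle Rintegral_ge0 ?andbT; last by move=> x _; exact: mollifier_ge0.
apply/negP => /eqP I0.
have c0 xi : cosft (mollifier e) xi = 0.
  apply/eqP; rewrite -normr_le0; apply: le_trans (cosft_le xi (mollifier_integrable e)) _.
  under eq_Rintegral do rewrite (ger0_norm (mollifier_ge0 _ _)).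
  by rewrite -I0.
have := mollifier_inversion e (0, 0).
rewrite {1}/cosft; under eq_Rintegral do rewrite c0 mul0r.
rewrite Rintegral_cst// mul0r => /esym/eqP; apply/negP.
rewrite mulf_neq0 ?expf_neq0 ?mulf_neq0 ?gt_eqF ?pi_gt0//.
rewrite /mollifier/= expr0n/= addr0 subr0 /beta exprn_gt0// expr0 mul1r; exact: expR_gt0.
Qed.

Lemma mollifier_support e (x : R * R) : 0 < e -> mollifier e x != 0 -> `|x.1| < e /\ `|x.2| < e.
Proof.
move=> e0 /eqP hx.
have : ~~ (e ^+ 2 <= x.1 ^+ 2 + x.2 ^+ 2).
  by apply/negP => h; apply: hx; exact: (bumpy_support (bumpy_beta _ _) h).
rewrite -ltNge => h.
have a (y z : R) : y ^+ 2 + z ^+ 2 < e ^+ 2 -> `|y| < e.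
  move=> yz; rewrite -(ltr_pXn2r (ltn0Sn 1)) ?nnegrE ?(ltW e0)//.
  by rewrite real_normK ?num_real// (le_lt_trans _ yz)// lerDl sqr_ge0.
by split; [exact: (a _ x.2)|apply: (a _ x.1); rewrite addrC].
Qed.

Definition mollify n (h : R * R -> R) : R :=
  (\int[mu2]_x (h x * mollifier n.+1%:R^-1 x)) / \int[mu2]_x mollifier n.+1%:R^-1 x.

(** The bump lives in a disc of radius [1/(n+1)], where [h] is close to its value
    at the origin. *)
Lemma mollify_cvg (h : R * R -> R) : measurable_fun setT h -> {for (0, 0), continuous h} ->
  mollify n h @[n --> \oo] --> h (0, 0).
Proof.
move=> mh ch; apply/cvgrPdist_le => eps eps0.
have /cvgrPdist_le/(_ _ eps0)/nbhs_ballP[d /= d0 hd] := ch.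
near=> n.
have e0 : 0 < n.+1%:R^-1 :> R by [].
have nd : n.+1%:R^-1 < d by near: n; exact: near_infty_natSinv_lt (PosNum d0).
set e := n.+1%:R^-1 in e0 nd.
have ib := mollifier_integrable e; have mb := integrable_measurable ib.
have I0 := mollifier_mass e0.
have hb x : `|h (0, 0) - h x| * mollifier e x <= eps * mollifier e x.
  have [->|/mollifier_support] := eqVneq (mollifier e x) 0; first by rewrite !mulr0.
  move=> /(_ e0)[x1 x2]; rewrite ler_wpM2r ?mollifier_ge0//; apply: hd.
  by split; rewrite /ball/= sub0r normrN; exact: lt_trans nd.
have ih : mu2.-integrable setT (EFin \o (fun x => h x * mollifier e x)).
  have := integrableZl measurableT (`|h (0, 0)| + eps) ib; apply: le_integrable => //.
    by apply/measurable_EFinP; exact: measurable_funM.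
  move=> x _; rewrite /= lee_fin normrM !(ger0_norm (mollifier_ge0 _ _)) [leRHS]ger0_norm; last first.
    by rewrite mulr_ge0 ?mollifier_ge0// addr_ge0// ltW.
  have := hb x; have := mollifier_ge0 e x; move: (mollifier e x) => b b0 hx.
  have : `|h x| * b <= (`|h (0, 0) - h x| + `|h (0, 0)|) * b.
    have {1}-> : h x = h (0, 0) - (h (0, 0) - h x) by ring.
    by apply: ler_wpM2r => //; rewrite [leRHS]addrC ler_normB.
  lra.
have icb : mu2.-integrable setT (EFin \o (fun x => h (0, 0) * mollifier e x)).
  exact: (integrableZl measurableT _ ib).
rewrite /mollify -/e -[X in `|X - _|](mulfK (lt0r_neq0 I0)) -mulrBl normrM.
rewrite (@ger0_norm _ _^-1) ?invr_ge0 ?(ltW I0)// ler_pdivrMr//.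
rewrite -RintegralZl// -RintegralB// -RintegralZl//.
have ibb : mu2.-integrable setT (EFin \o (fun x => h (0, 0) * mollifier e x - h x * mollifier e x)).
  exact: (integrableB measurableT icb ih).
apply: (le_trans (le_normr_Rintegral _ ibb)) => //.
apply: le_Rintegral => //.
- exact: integrable_norm.
- exact: (integrableZl measurableT _ ib).
- by move=> x _; rewrite -mulrBl normrM (ger0_norm (mollifier_ge0 _ _)).
Unshelve. all: by end_near. Qed.

End approximate_identity.

Local Open Scope complex_scope.

(** * The semigroup at the origin *)

Section semigroup.
Context {R : realType}.
Local Notation mu := (@lebesgue_measure R).
Local Notation mu2 := (@leb2 R).
Implicit Types (F G : R * R -> R).

Lemma odd_Rintegral2 F : mu2.-integrable setT (EFin \o F) ->
  (forall x, F (- x.1, - x.2) = - F x) -> \int[mu2]_x F x = 0.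
Proof.
move=> iF oF; have := Rintegral_opp (integrable_measurable iF).
under eq_Rintegral do rewrite oF -mulN1r.
by rewrite RintegralZl// => h; lra.
Qed.

Lemma rot_invariant_opp F x : rot_invariant F -> F (- x.1, - x.2) = F x.
Proof.
move=> rF; have cs : (-1) ^+ 2 + 0 ^+ 2 = 1 :> R by ring.
by rewrite -(rF (-1) 0 x cs) /rotation; congr F; congr pair; ring.
Qed.

Lemma CintE (h : R * R -> R[i]) (u v : R * R -> R) :
  (forall x, h x = u x +i* v x) -> Cint h = (\int[mu2]_x u x) +i* (\int[mu2]_x v x).
Proof.
by move=> hE; rewrite /Cint; congr (_ +i* _); apply: eq_Rintegral => x _; rewrite hE.
Qed.

Lemma measurable_sin_dot2 (xi : R * R) : measurable_fun setT (fun x : R * R => sin (dot2 x xi)).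
Proof.
apply: measurableT_comp; first by apply: continuous_measurable_fun; exact: continuous_sin.
by apply: measurable_funD; apply: measurable_funM.
Qed.

Lemma even_sin_integral0 F xi : mu2.-integrable setT (EFin \o F) ->
  (forall x, F (- x.1, - x.2) = F x) -> \int[mu2]_x (F x * sin (dot2 x xi)) = 0.
Proof.
move=> iF eF; apply: odd_Rintegral2 => [|x].
  exact: (integrable_mul_bounded iF (measurable_sin_dot2 xi) (fun x => sin_max _)).
rewrite eF (_ : dot2 _ _ = - dot2 x xi) ?sinN ?mulrN//.
by rewrite /dot2/=; ring.
Qed.

Lemma fourier_even F xi : mu2.-integrable setT (EFin \o F) ->
  (forall x, F (- x.1, - x.2) = F x) ->
  fourier F xi = (((2 * pi) ^+ 2)^-1 * cosft F xi)%:C.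
Proof.
move=> iF eF; rewrite /fourier (@CintE _ (fun x => F x * cos (dot2 x xi)) (fun x => -1 * (F x * sin (dot2 x xi)))).
  rewrite RintegralZl//; last exact: (integrable_mul_bounded iF (measurable_sin_dot2 xi) (fun x => sin_max _)).
  by rewrite even_sin_integral0// mulr0 /cosft rmorphM.
by move=> x; rewrite /expi cosN sinN; simpc; congr (_ +i* _); ring.
Qed.

Lemma inv_fourier_even F x : mu2.-integrable setT (EFin \o F) ->
  (forall x, F (- x.1, - x.2) = F x) ->
  inv_fourier (fun xi => (F xi)%:C) x = (cosft F x)%:C.
Proof.
move=> iF eF; rewrite /inv_fourier (@CintE _ (fun xi => F xi * cos (dot2 xi x)) (fun xi => F xi * sin (dot2 xi x))).
  by rewrite even_sin_integral0.
by move=> xi; rewrite dot2C /expi; simpc.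
Qed.

Lemma normc_real (x : R) : `|x%:C| = `|x|%:C.
Proof. by rewrite normc_def/= expr0n addr0 sqrtr_sqr. Qed.

Lemma smooth_cst (c : R) : smooth (fun _ : R * R => c).
Proof.
move=> n; elim: n c => [|n IHn] c; split => //=; try by move=> x; exact: cvg_cst.
have D0 (v : R * R) : (fun x => 'D_v (fun _ : R * R => c) x) = (fun _ => 0).
  by apply/funext => x; rewrite -[fun _ => c]/(cst c) derive_cst.
by split; rewrite ?D0// => x; exact: derivable_cst.
Qed.

Lemma measurable_direction : measurable_fun setT (fun x : R * R => x.1 / enorm x).
Proof. by apply: measurable_funM => //; exact: measurable_enormV. Qed.

(** The real part is [rotation_average], and the imaginary part is the integral
    of an odd function. *)
Lemma semigroup_average t F : mu2.-integrable setT (EFin \o F) -> rot_invariant F ->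
  Cint (fun xi => (F xi)%:C * semigroup_symbol t xi) = (bessel t * \int[mu2]_x F x)%:C.
Proof.
move=> iF rF.
rewrite (@CintE _ (fun xi => F xi * cos (t * (xi.1 / enorm xi))) (fun xi => F xi * - sin (t * (xi.1 / enorm xi)))).
  have s0 : \int[mu2]_x (F x * - sin (t * (x.1 / enorm x))) = 0.
    apply: odd_Rintegral2 => [|x].
      apply: (@integrable_mul_bounded _ F (fun x => - sin (t * (x.1 / enorm x))) iF) => [|x].
        apply: measurableT_comp => //; apply: measurableT_comp.
          by apply: continuous_measurable_fun; exact: continuous_sin.
        by apply: measurable_funM => //; exact: measurable_direction.
      by rewrite normrN sin_max.
    have -> : enorm (- x.1, - x.2) = enorm x.
      by apply: (@rot_invariant_opp (@enorm R)) => c s y; exact: enorm_rotation.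
    by rewrite rot_invariant_opp//= mulNr [t * - _]mulrN sinN opprK mulrN opprK.
  by rewrite rotation_average// s0.
by move=> xi; rewrite /semigroup_symbol /expi cosN sinN; simpc.
Qed.

Section radial_data.
Variable f : R * R -> R.
Hypotheses (f_smooth : smooth f) (f_radial : radial f) (f_L1 : L1 f).

Let iF : mu2.-integrable setT (EFin \o f). Proof. exact: f_L1. Qed.

Let rf : rot_invariant f.
Proof. by move=> c s x cs; apply: f_radial; exact: enorm_rotation. Qed.

Let ef x : f (- x.1, - x.2) = f x. Proof. exact: rot_invariant_opp. Qed.

Let cf : continuous f. Proof. by have [] := f_smooth 0%N. Qed.

(** The Fourier transform of [f], which is real since [f] is even. *)
Definition rfourier (xi : R * R) : R := ((2 * pi) ^+ 2)^-1 * cosft f xi.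

Lemma fourier_radial xi : fourier f xi = (rfourier xi)%:C.
Proof. exact: fourier_even. Qed.

Lemma rfourier_rot : rot_invariant rfourier.
Proof.
by move=> c s x cs; rewrite /rfourier cosft_rot_invariant//; exact: (integrable_measurable iF).
Qed.

Lemma measurable_rfourier : measurable_fun setT rfourier.
Proof. by apply: measurable_funM => //; exact: measurable_cosft. Qed.

Lemma rfourier_bounded : exists2 M, 0 <= M & forall xi, `|rfourier xi| <= M.
Proof.
exists (((2 * pi) ^+ 2)^-1 * \int[mu2]_x `|f x|) => [|xi].
  by rewrite mulr_ge0// ?invr_ge0 ?exprn_ge0 ?mulr_ge0 ?pi_ge0// Rintegral_ge0.
rewrite normrM ger0_norm ?invr_ge0 ?exprn_ge0 ?mulr_ge0 ?pi_ge0//.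
by rewrite ler_wpM2l ?cosft_le// ?invr_ge0 ?exprn_ge0 ?mulr_ge0 ?pi_ge0.
Qed.

(** The multiplication formula moves the transform to the bump, where inversion
    applies. *)
Lemma rfourier_pairing e :
  \int[mu2]_xi (cosft (mollifier e) xi * rfourier xi) = \int[mu2]_x (f x * mollifier e x).
Proof.
have im := @mollifier_cosft_integrable R e.
have := multiplication_formula iF im; have := mollifier_inversion e.
have : (2 * pi) ^+ 2 != 0 :> R by rewrite expf_neq0// mulf_neq0// gt_eqF// pi_gt0.
rewrite /rfourier; move: ((2 * pi) ^+ 2) => K K0 inv mf.
have imf : mu2.-integrable setT (EFin \o (fun xi => cosft (mollifier e) xi * cosft f xi)).
  exact: (integrable_mul_le im (measurable_cosft iF) (fun xi => cosft_le xi iF)).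
have ifm : mu2.-integrable setT (EFin \o (fun x => f x * cosft (cosft (mollifier e)) x)).
  exact: (integrable_mul_le iF (measurable_cosft im) (fun xi => cosft_le xi im)).
transitivity (K^-1 * \int[mu2]_xi (cosft (mollifier e) xi * cosft f xi)).
  by rewrite -RintegralZl//; apply: eq_Rintegral => xi _; ring.
rewrite mf -RintegralZl//.
by apply: eq_Rintegral => x _; rewrite inv; field.
Qed.

(** Test against the transforms of the normalized bumps, which are bounded by 1
    and tend to 1 pointwise. *)
Lemma integral_rfourier : mu2.-integrable setT (EFin \o rfourier) ->
  \int[mu2]_xi rfourier xi = f (0, 0).
Proof.
move=> ir.
have h1 := mollify_cvg (integrable_measurable iF) (@cf (0, 0)).
suff h2 : mollify n f @[n --> \oo] --> \int[mu2]_xi rfourier xi.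
  by rewrite -(cvg_lim _ h2)//; exact: cvg_lim.
pose m n (xi : R * R) := mollify n (fun x => cos (dot2 x xi)).
have mE n xi : m n xi = cosft (mollifier n.+1%:R^-1) xi / \int[mu2]_x mollifier n.+1%:R^-1 x.
  by rewrite /m /mollify; congr (_ / _); apply: eq_Rintegral => x _; rewrite mulrC.
have mc n xi : measurable_fun setT (fun xi => m n xi).
  rewrite (funext (mE n)); apply: measurable_funM => //; apply: measurable_cosft; exact: mollifier_integrable.
have I0 n : 0 < \int[mu2]_x mollifier n.+1%:R^-1 x :> R by exact: mollifier_mass.
have m1 n xi : `|m n xi| <= 1.
  rewrite mE normrM (@ger0_norm _ _^-1) ?invr_ge0 ?(ltW (I0 n))// ler_pdivrMr// mul1r.
  apply: le_trans (cosft_le _ (mollifier_integrable _)) _.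
  by under eq_Rintegral do rewrite ger0_norm ?mollifier_ge0//.
have -> : (fun n => mollify n f) = fun n => \int[mu2]_xi (rfourier xi * m n xi).
  apply/funext => n; rewrite /mollify -rfourier_pairing -RintegralZr//; last first.
    have [M M0 hM] := rfourier_bounded.
    exact: (integrable_mul_le (mollifier_cosft_integrable _) measurable_rfourier hM).
  by apply: eq_Rintegral => xi _; rewrite mE; ring.
apply: (@Rdominated_cvg _ _ R mu2 _ _ (fun xi => `|rfourier xi|)).
- by move=> n; apply: measurable_funM; [exact: measurable_rfourier|exact: mc].
- exact: measurable_rfourier.
- exact: integrable_norm.
- by move=> n xi; rewrite normrM ler_piMr.
- move=> xi; rewrite -[X in _ --> X]mulr1; apply: cvgM; first exact: cvg_cst.
  have cd : continuous (fun x : R * R => cos (dot2 x xi)).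
    have c2 : continuous (fun x : R * R => dot2 x xi).
      move=> x; apply: cvgD; apply: cvgM; first exact: cvg_fst.
      - exact: cvg_cst.
      - exact: cvg_snd.
      - exact: cvg_cst.
    move=> x; exact: (continuous_comp (c2 x) (@continuous_cos R _)).
  have := @mollify_cvg R (fun x => cos (dot2 x xi)) (measurable_cos_dot2 xi) (@cd (0, 0)).
  by rewrite {2}/dot2/= !mul0r addr0 cos0.
Qed.

(** If the transform is integrable, evaluate the integral at the origin.
    Otherwise test against the bumps and let them shrink. *)
Lemma semigroup_at_origin t g : is_semigroup f t g -> g (0, 0) = (f (0, 0) * bessel t)%:C.
Proof.
move=> [hint hdist].
have sE : (fun xi => fourier f xi * semigroup_symbol t xi) =
          (fun xi => (rfourier xi)%:C * semigroup_symbol t xi).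
  by apply/funext => xi; rewrite fourier_radial.
rewrite sE in hint hdist.
have [cl|ncl] := pselect (CL1 (fourier f)).
  have ir : mu2.-integrable setT (EFin \o rfourier).
    have [h _] := cl; have h' : mu2.-integrable setT (EFin \o (fun x => complex.Re (fourier f x))) by exact: h.
    by apply: eq_integrable h' => // xi _; rewrite /comp fourier_radial.
  rewrite hint//; rewrite /inv_fourier.
  rewrite (_ : (fun xi => _) = (fun xi => (rfourier xi)%:C * semigroup_symbol t xi)); last first.
    apply/funext => xi; rewrite (_ : dot2 (0, 0) xi = 0); last by rewrite /dot2/= !mul0r addr0.
    by rewrite /expi cos0 sin0 mulr1.
  by rewrite semigroup_average//; [rewrite integral_rfourier// mulrC|exact: rfourier_rot].
have [[cRe cIm] hg] := hdist ncl.
pose b n := mollifier (n.+1%:R^-1 : R).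
have pairing n : (bessel t * \int[mu2]_x (f x * b n x))%:C =
    (\int[mu2]_x (complex.Re (g x) * b n x)) +i* (\int[mu2]_x (complex.Im (g x) * b n x)).
  have tb : test_function (fun x => (b n x)%:C).
    have bb : bumpy n.+1%:R^-1 (b n) by exact: bumpy_beta.
    split.
    - exact: bumpy_smooth bb.
    - exact: (@smooth_cst 0).
    - exists n.+1%:R^-1 => x hx; rewrite (bumpy_support bb)// -enorm_sqr.
      by rewrite ler_pXn2r// ?nnegrE ?enorm_ge0 ?(ltW hx).
  rewrite -(@CintE (fun x => g x * (b n x)%:C)); last first.
    by move=> x; case: (g x) => u v; simpc.
  rewrite -[RHS]/(dist_of g (fun x => (b n x)%:C)) -hg// /inv_fourier_dist /dist_of.
  have im := @mollifier_cosft_integrable R n.+1%:R^-1.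
  have [M _ hM] := rfourier_bounded.
  have imr : mu2.-integrable setT (EFin \o (fun xi => cosft (b n) xi * rfourier xi)).
    exact: (integrable_mul_le im measurable_rfourier hM).
  rewrite -rfourier_pairing -semigroup_average//; last first.
    move=> c s x cs; rewrite rfourier_rot// cosft_rot_invariant//; last exact: mollifier_rot.
    exact: (integrable_measurable (mollifier_integrable _)).
  congr Cint; apply/funext => xi.
  rewrite inv_fourier_even; [|exact: mollifier_integrable|].
    by rewrite -/(b n) rmorphM/=; ring.
  by move=> x; apply: rot_invariant_opp; exact: mollifier_rot.
have mRe : measurable_fun setT (fun x => complex.Re (g x)) by exact: continuous_measurable2.
have mIm : measurable_fun setT (fun x => complex.Im (g x)) by exact: continuous_measurable2.
have hRe := mollify_cvg mRe (@cRe (0, 0)).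
have hIm := mollify_cvg mIm (@cIm (0, 0)).
have hf := mollify_cvg (integrable_measurable iF) (@cf (0, 0)).
have eRe : complex.Re (g (0, 0)) = bessel t * f (0, 0).
  rewrite -(cvg_lim _ hRe)//; apply: cvg_lim => //.
  rewrite (_ : (fun n => _) = (fun n => bessel t * mollify n f)); first by apply: cvgM => //; exact: cvg_cst.
  apply/funext => n; rewrite /mollify mulrA; congr (_ / _).
  by have := congr1 (@complex.Re R) (pairing n).
have eIm : complex.Im (g (0, 0)) = 0.
  rewrite -(cvg_lim _ hIm)//; apply: cvg_lim => //.
  rewrite (_ : (fun n => _) = (fun n => 0)); first exact: cvg_cst.
  apply/funext => n; rewrite /mollify.
  by have /= <- := congr1 (@complex.Im R) (pairing n); rewrite mul0r.
by move: eRe eIm; case: (g _) => u v /= -> ->; rewrite mulrC.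
Qed.

End radial_data.
End semigroup.

Unset Implicit Arguments.

Theorem proposition2p3 (R : realType) (f : R * R -> R)
    (f_smooth : smooth f) (f_radial : radial f) (f_L1 : L1 f)
    (f0_neq0 : f (0, 0) != 0)
    (eR1 : R -> R * R -> R[i])
    (eR1_def : forall t : R, 0 < t -> is_semigroup f t (eR1 t)) :
  (fun t : R => eR1 t (0, 0) : R[i]^o) =
  (fun t : R =>
     (f (0, 0) * Num.sqrt (2 / (pi * t)) * cos (t - pi / 4))%:C : R[i]^o)
  +o_ +oo (fun t : R => (t `^ (- 2^-1))%:C : R[i]^o).
Proof.
have [C hC] := @bessel_asymptotics R.
apply/eqaddoP => eps eps0.
have [e epsE e0] : exists2 e : R, eps = e%:C & 0 < e.
  case: eps eps0 => a b; rewrite ltcE/= => /andP[/eqP b0 a0]; exists a => //.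
  by rewrite b0.
near=> t.
have t1 : 1 <= t by near: t; apply: nbhs_pinfty_ge; exact: num_real.
(* C / t is below e t^(-1/2) / |f(0)| as soon as sqrt t exceeds |f(0)| C / e. *)
have tK : (`|f (0, 0)| * C / e) ^+ 2 <= t by near: t; apply: nbhs_pinfty_ge; exact: num_real.
have t0 : 0 < t := lt_le_trans ltr01 t1.
rewrite [X in `|X|](_ : _ = (f (0, 0) * (bessel t - Num.sqrt (2 / (pi * t)) * cos (t - pi / 4)))%:C); last first.
  have distr (u v w : R) : (f (0, 0) * (u - v * w))%:C = (f (0, 0) * u)%:C - (f (0, 0) * v * w)%:C.
    by rewrite mulrBr mulrA (rmorphB (real_complex R)).
  rewrite distr.
  by rewrite -(semigroup_at_origin f_smooth f_radial f_L1 (eR1_def t t0)).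
rewrite epsE.
rewrite !normc_real.
rewrite -rmorphM/= lecR normrM (ger0_norm (powR_ge0 _ _)) powRN powR12_sqrt ?(ltW t0)//.
have r0 : 0 < Num.sqrt t by rewrite sqrtr_gt0.
apply: (@le_trans _ _ (`|f (0, 0)| * (C / t))); first by rewrite ler_wpM2l// hC.
rewrite ler_pdivlMr// -{1}(sqr_sqrtr (ltW t0)).
rewrite (_ : _ * _ * _ = `|f (0, 0)| * C / Num.sqrt t); last by field; exact: lt0r_neq0.
rewrite ler_pdivrMr// -ler_pdivrMl// mulrC.
apply: le_trans (ler_norm _) _; rewrite -sqrtr_sqr; exact: ler_wsqrtr.
Unshelve. all: by end_near. Qed.
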